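(* Let $G$ be a finite simple graph. Let $E_1=K_4$ be the complete graph on four vertices. Let $E_2$ be the graph consisting of two vertices joined by three internally vertex-disjoint paths, each with exactly three edges (so $E_2$ has $8$ vertices and $9$ edges). Let $E_3$ be the graph on six vertices $a,b,c,x,y,z$ with edge set $\{ab,bc,ca,xa,xb,yb,yc,zc,za\}$ (a triangle with a further triangle glued along each of its edges). Then the following three statements are equivalent. (i) $G$ is $2$-connected and the path-width of $G$ is at most $2$. (ii) $G$ is a track. (iii) $G$ is $2$-connected and none of $E_1,E_2,E_3$ is a minor of $G$.
   Context: All graphs are finite and simple. A graph is $2$-connected if it has at least three vertices, is connected, and remains connected after the deletion of any one vertex. A graph $H$ is a minor of $G$ if (a graph isomorphic to) $H$ can be obtained from a subgraph of $G$ by contracting edges, where multiple edges arising from contractions are replaced by single edges. A path-decomposition of a graph $G$ is a pair $(P,W)$, where $P$ is a path and $W=(W_p : p\in V(P))$ is a family of subsets of $V(G)$ such that (1) $\bigcup_{p\in V(P)}W_p=V(G)$ and every edge of $G$ has both ends in some $W_p$; and (2) if $p,p',p''\in V(P)$ and $p'$ lies on the path from $p$ to $p''$ in $P$, then $W_p\cap W_{p''}\subseteq W_{p'}$. Its width is $\max(|W_p|-1 : p\in V(P))$, and the path-width of $G$ is the minimum width of a path-decomposition of $G$. Tracks. Let $P=p_1p_2\ldots p_k$ and $Q=q_1q_2\ldots q_\ell$ be two vertex-disjoint paths, with $k,\ell\ge 1$ (a path may consist of a single vertex). A short chord is an edge connecting a vertex of $P$ to a vertex of $Q$. A long chord is a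 path of length two $p_i\,m\,q_j$ connecting a vertex $p_i$ of $P$ to a vertex $q_j$ of $Q$, whose middle node $m$ lies on neither $P$ nor $Q$ and has degree $2$ in the whole graph; thus different long chords have different middle nodes. A chord is a short chord or a long chord. A chord connecting $p_i$ and $q_j$ is called an $ij$-chord. An $ij$-chord and an $i'j'$-chord are noncrossing if and only if $(i-i')(j-j')\ge 0$. Several chords with the same pair of ends $p_i,q_j$ are allowed (at most one of them being short, since the graph is simple). A graph $G$ is called a track if and only if it is $2$-connected and it can be represented as the union of two vertex-disjoint paths $P=p_1p_2\ldots p_k$ and $Q=q_1q_2\ldots q_\ell$ (with $k,\ell\ge 1$) and a family of pairwise noncrossing chords between them, each of which is a short chord or a long chord, such that $p_1$ and $q_1$ are connected by a chord and $p_k$ and $q_\ell$ are connected by a chord. *)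

(* Defs.v *)
From mathcomp Require Import all_boot all_order all_algebra.
From mathcomp Require Import boolp.

Set Implicit Arguments.
Unset Strict Implicit.
Unset Printing Implicit Defensive.

Record sgraph := SGraph {
  vertex :> finType;
  adj : rel vertex;
  adj_sym : symmetric adj;
  adj_irrefl : irreflexive adj }.

Arguments adj {s} x y.

Definition degree (G : sgraph) (x : G) : nat := #|[set y : G | adj x y]|.

Definition iso (G H : sgraph) : Prop :=
  exists f : G -> H, bijective f /\ forall x y : G, adj (f x) (f y) = adj x y.

Definition connected (G : sgraph) : Prop :=
  0 < #|G| /\ forall x y : G, connect (@adj G) x y.

Definition del_adj (G : sgraph) (v : G) : rel {x : G | x != v} :=
  fun x y => adj (val x) (val y).

Lemma del_adj_sym (G : sgraph) (v : G) : symmetric (@del_adj G v).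
Proof. by move=> x y; exact: adj_sym. Qed.

Lemma del_adj_irrefl (G : sgraph) (v : G) : irreflexive (@del_adj G v).
Proof. by move=> x; exact: adj_irrefl. Qed.

Definition del_vertex (G : sgraph) (v : G) : sgraph :=
  SGraph (@del_adj_sym G v) (@del_adj_irrefl G v).

Definition two_connected (G : sgraph) : Prop :=
  [/\ 3 <= #|G|, connected G & forall v : G, connected (del_vertex v)].

(* [S] is isomorphic to a (not necessarily induced) subgraph of [G]. *)
Definition embeds (S G : sgraph) : Prop :=
  exists f : S -> G,
    injective f /\ forall x y : S, adj x y -> adj (f x) (f y).

(* [x] stands for the vertex obtained by merging [x] and [y]; the test
   [u != v] removes the loop, and parallel edges merge since [adj] is a
   relation. *)
Definition contract_adj (G : sgraph) (x y : G) : rel {z : G | z != y} :=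
  fun u v => (u != v) &&
    [|| adj (val u) (val v),
        (val u == x) && adj y (val v)
      | (val v == x) && adj y (val u)].

Lemma contract_adj_sym (G : sgraph) (x y : G) :
  symmetric (@contract_adj G x y).
Proof.
by move=> u v; rewrite /contract_adj eq_sym [adj (val u) _]adj_sym
  [X in _ || X]orbC.
Qed.

Lemma contract_adj_irrefl (G : sgraph) (x y : G) :
  irreflexive (@contract_adj G x y).
Proof. by move=> u; rewrite /contract_adj eqxx. Qed.

Definition contract (G : sgraph) (x y : G) : sgraph :=
  SGraph (@contract_adj_sym G x y) (@contract_adj_irrefl G x y).

Inductive contracts_to : sgraph -> sgraph -> Prop :=
| contracts_refl (G : sgraph) : contracts_to G G
| contracts_step (G H : sgraph) (x y : G) :
    adj x y -> contracts_to (contract x y) H -> contracts_to G H.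

Definition minor (H G : sgraph) : Prop :=
  exists S K : sgraph, [/\ embeds S G, contracts_to S K & iso K H].

(* The path [P] has vertices 0, 1, ..., n in this order. *)
Definition path_decomposition (G : sgraph) (n : nat)
    (W : 'I_n.+1 -> {set G}) : Prop :=
  [/\ forall v : G, exists i, v \in W i,
      forall u v : G, adj u v -> exists i, (u \in W i) && (v \in W i)
    & forall i j k : 'I_n.+1, i <= j <= k -> W i :&: W k \subset W j].

(* The predecessor truncates at 0, which affects only the graph without
   vertices. *)
Definition width (G : sgraph) (n : nat) (W : 'I_n.+1 -> {set G}) : nat :=
  \max_(i < n.+1) #|W i|.-1.

Definition has_decomposition_of_width (G : sgraph) (w : nat) : Prop :=
  exists (n : nat) (W : 'I_n.+1 -> {set G}),
    path_decomposition W /\ width W = w.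

Lemma decomposition_exists (G : sgraph) :
  exists w : nat, `[< has_decomposition_of_width G w >].
Proof.
exists (width (fun _ : 'I_1 => [set: G])); apply/asboolP.
exists 0, (fun _ => [set: G]); split=> //; split.
- by move=> v; exists ord0; rewrite inE.
- by move=> u v _; exists ord0; rewrite !inE.
- by move=> i j k _; exact: subsetT.
Qed.

Definition pathwidth (G : sgraph) : nat := ex_minn (decomposition_exists G).

(* A path with vertices [p 0], [p 1], ..., [p k]; indices start from 0. *)
Definition is_path (G : sgraph) (k : nat) (p : 'I_k.+1 -> G) : Prop :=
  injective p /\
  forall i j : 'I_k.+1, j = i.+1 :> nat -> adj (p i) (p j).

Definition path_edge (G : sgraph) (k : nat) (p : 'I_k.+1 -> G) (u v : G) :
    Prop :=
  exists i j : 'I_k.+1, j = i.+1 :> nat /\ [set u; v] = [set p i; p j].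

(* [(i, j, None)] is the short ij-chord, and [(i, j, Some m)] is the long
   ij-chord with middle node [m]. *)
Definition chord (G : sgraph) (k l : nat) : finType :=
  ('I_k.+1 * 'I_l.+1 * option G)%type.

Section Chords.

Variables (G : sgraph) (k l : nat) (p : 'I_k.+1 -> G) (q : 'I_l.+1 -> G).

Definition is_chord (c : chord G k l) : Prop :=
  let: (i, j, o) := c in
  match o with
  | None => adj (p i) (q j)
  | Some m => [/\ adj (p i) m, adj m (q j), degree m = 2,
                  forall i', m <> p i' & forall j', m <> q j']
  end.

Definition chord_edge (c : chord G k l) (u v : G) : Prop :=
  let: (i, j, o) := c in
  match o with
  | None => [set u; v] = [set p i; q j]
  | Some m => [set u; v] = [set p i; m] \/ [set u; v] = [set m; q j]
  end.

Definition noncrossing (c c' : chord G k l) : Prop :=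
  let: (i, j, _) := c in
  let: (i', j', _) := c' in
  (0 <= (i%:Z - i'%:Z) * (j%:Z - j'%:Z))%R.

Definition connected_by_chord (C : {set chord G k l})
    (i : 'I_k.+1) (j : 'I_l.+1) : Prop :=
  exists o : option G, (i, j, o) \in C.

(* Given that the paths and the chords lie in [G], their union is [G] as soon
   as it contains all vertices and all edges of [G]. *)
Definition covers (C : {set chord G k l}) : Prop :=
  (forall v : G, [\/ exists i, v = p i, exists j, v = q j
                   | exists i j, (i, j, Some v) \in C]) /\
  (forall u v : G, adj u v ->
     [\/ path_edge p u v, path_edge q u v
       | exists2 c, c \in C & chord_edge c u v]).

Definition track_representation (C : {set chord G k l}) : Prop :=
  [/\ [/\ is_path p, is_path q & forall i j, p i <> q j],
      forall c, c \in C -> is_chord c,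
      forall c c', c \in C -> c' \in C -> noncrossing c c',
      connected_by_chord C ord0 ord0 /\ connected_by_chord C ord_max ord_max
    & covers C].

End Chords.

Definition track (G : sgraph) : Prop :=
  two_connected G /\
  exists (k l : nat) (p : 'I_k.+1 -> G) (q : 'I_l.+1 -> G)
         (C : {set chord G k l}), track_representation p q C.

Definition edges_adj (n : nat) (s : seq (nat * nat)) : rel 'I_n :=
  fun x y => (x != y) &&
    (((x : nat, y : nat) \in s) || ((y : nat, x : nat) \in s)).

Lemma edges_adj_sym (n : nat) (s : seq (nat * nat)) :
  symmetric (@edges_adj n s).
Proof. by move=> x y; rewrite /edges_adj eq_sym orbC. Qed.

Lemma edges_adj_irrefl (n : nat) (s : seq (nat * nat)) :
  irreflexive (@edges_adj n s).
Proof. by move=> x; rewrite /edges_adj eqxx. Qed.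

Definition graph_of_edges (n : nat) (s : seq (nat * nat)) : sgraph :=
  SGraph (@edges_adj_sym n s) (@edges_adj_irrefl n s).

Definition E1 : sgraph :=
  graph_of_edges 4 [:: (0, 1); (0, 2); (0, 3); (1, 2); (1, 3); (2, 3)].

(* The two joined vertices are 0 and 1. *)
Definition E2 : sgraph :=
  graph_of_edges 8
    [:: (0, 2); (2, 3); (3, 1);
        (0, 4); (4, 5); (5, 1);
        (0, 6); (6, 7); (7, 1)].

(* a, b, c, x, y, z are 0, 1, 2, 3, 4, 5. *)
Definition E3 : sgraph :=
  graph_of_edges 6
    [:: (0, 1); (1, 2); (2, 0);
        (3, 0); (3, 1); (4, 1); (4, 2); (5, 2); (5, 0)].

(* Main.v *)
Require Import Defs.
From mathcomp Require Import all_boot all_order all_algebra.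
From mathcomp Require Import boolp zify.

Set Implicit Arguments.
Unset Strict Implicit.
Unset Printing Implicit Defensive.

(** A track has path-width at most 2 because it can be swept: start with the
    two first vertices of the paths and advance along either path, one vertex
    at a time.  If the current ends are p_i and q_j, then two chords p_i q_b
    with b > j and p_a q_j with a > i would cross, so one of the two ends has
    no chord leading ahead and can be left behind.  Visited vertices with
    unvisited neighbours are thus always among two vertices, and together with
    the vertex being added they form the bags ([ladder_sweep], [sweep_bags]).

    Bounds on the bags of a path-decomposition pass to minors
    ([bags_le_minor]).  In a graph with a decomposition into bags of size at
    most w + 1, for every t from 1 to the number of vertices there is a set of
    t vertices with at most w outer neighbours ([small_nbhd]).  This fails for w = 2 in E1, E2, E3 with t equal
    to 1, 3, 2, so a graph of path-width at most 2 has none of them as a minor.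

    Conversely let G be 2-connected without these minors, and let s be a
    longest cycle of G.  An ear of s with two or more inner vertices would form
    with the two arcs between its ends, which are at least as long, a graph
    that contracts to E2 ([longest_ear_size1]).  By 2-connectivity every vertex
    outside s then has all its neighbours on s, and at least two of them; it
    has exactly two, since three would give K4 ([nbrs_of_outside]).  Hence G
    consists of s and of bridges, which are chords of s or paths of length two.
    Crossing bridges give K4 ([bridges_no_cross]), and three bridges cutting
    off arcs of s without common edges give E3 ([bridges_no_triangle]).  Start s
    at an edge inside a shortest arc cut off by a bridge: the bridges then
    span intervals of positions that are totally ordered by inclusion
    ([exists_nested]).  Removing that edge and an edge inside the innermost
    interval leaves two paths, between which the bridges run as pairwise
    noncrossing chords ([nested_track]). *)

(** * Path-decompositions with small bags and minors *)

(** Stated with bag sizes, since the predecessor in [width] is awkward to bound. *)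
Definition bags_le (G : sgraph) (w : nat) : Prop :=
  exists (n : nat) (W : 'I_n.+1 -> {set G}),
    path_decomposition W /\ forall i, #|W i| <= w.+1.

Lemma pathwidth_leP (G : sgraph) (w : nat) : pathwidth G <= w <-> bags_le G w.
Proof.
rewrite /pathwidth; split.
  case: ex_minnP => m /asboolP[n [W [decW <-]]] _ /bigmax_leqP le_w.
  by exists n, W; split=> // i; have := le_w i isT; case: #|W i|.
case=> n [W [decW le_w]]; case: ex_minnP => m _ min_m.
apply: (@leq_trans (width W)).
  by apply: min_m; apply/asboolP; exists n, W.
by apply/bigmax_leqP => i _; have := le_w i; case: #|W i|.
Qed.

Lemma bags_le_embeds (S G : sgraph) (w : nat) :
  embeds S G -> bags_le G w -> bags_le S w.
Proof.
case=> f [f_inj f_adj] [n [W [[cov_v cov_e conv] le_w]]].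
exists n, (fun i => f @^-1: W i); split; first split.
- by move=> v; have [i vi] := cov_v (f v); exists i; rewrite inE.
- move=> u v /f_adj /cov_e[i uvi]; exists i; by rewrite !inE.
- move=> i j k le_ijk; apply/subsetP => v; rewrite !inE => vik.
  by apply: (subsetP (conv i j k le_ijk)); rewrite inE.
- move=> i; apply: leq_trans (le_w i).
  rewrite -(card_imset _ f_inj); apply: subset_leq_card.
  by apply/subsetP => _ /imsetP[x xi ->]; rewrite inE in xi.
Qed.

(** The merged vertex inherits the bags of x and those of y.  These two intervals
    share a bag because xy is an edge, so their union is an interval again; and no
    bag grows, because y leaves every bag in which x takes its place. *)
Lemma bags_le_contract (G : sgraph) (x y : G) (w : nat) :
  adj x y -> bags_le G w -> bags_le (contract x y) w.
Proof.
move=> xy [n [W [[cov_v cov_e conv] le_w]]].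
have neq_xy : x != y by apply: contraTneq xy => ->; rewrite adj_irrefl.
pose X : contract x y := Sub x neq_xy.
pose V i : {set contract x y} :=
  [set u | (val u \in W i) || (val u == x) && (y \in W i)].
have conv1 (i j k : 'I_n.+1) u : i <= j <= k ->
    u \in W i -> u \in W k -> u \in W j.
  move=> le_ijk ui uk; apply: (subsetP (conv i j k le_ijk)).
  by rewrite inE ui.
exists n, V; split; first split.
- by move=> v; have [i vi] := cov_v (val v); exists i; rewrite inE vi.
- move=> u v; rewrite /adj /= /contract_adj => /andP[_ /or3P[|/andP[ux yv]|/andP[vx yu]]].
  + by move=> /cov_e[i /andP[ui vi]]; exists i; rewrite !inE ui vi.
  + by have [i /andP[yi vi]] := cov_e _ _ yv; exists i; rewrite !inE ux yi vi orbT.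
  + by have [i /andP[yi ui]] := cov_e _ _ yu; exists i; rewrite !inE vx yi ui orbT.
- move=> i j k /andP[le_ij le_jk]; apply/subsetP => u; rewrite !inE.
  have [->{u}|_ /=] := eqVneq (val u) x; last first.
    by rewrite !orbF => /andP[ui uk]; apply: conv1 ui uk; rewrite le_ij.
  (* The intervals of bags of x and of y overlap in the bag a. *)
  have [a /andP[xa ya]] := cov_e _ _ xy.
  have glue u v : u \in W i -> v \in W k -> u \in W a -> v \in W a ->
      (u \in W j) || (v \in W j).
    move=> ui vk ua va; have [le_ja|lt_aj] := leqP j a.
      by rewrite (@conv1 i j a u) // le_ij.
    by rewrite (@conv1 a j k v) ?orbT // (ltnW lt_aj).
  rewrite /= => /andP[/orP[ui|ui] /orP[uk|uk]].
  + by rewrite (@conv1 i j k x) // le_ij.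
  + by rewrite glue.
  + by rewrite orbC glue.
  + by rewrite (@conv1 i j k y) ?orbT // le_ij.
- move=> i; apply: leq_trans (le_w i).
  have [xi|xi] := boolP (x \in W i).
    rewrite -(card_imset _ val_inj); apply: subset_leq_card.
    apply/subsetP => _ /imsetP[u ui ->]; move: ui; rewrite inE.
    by case/orP=> // /andP[/eqP-> _].
  pose f (u : contract x y) := if val u == x then y else val u.
  have f_inj : injective f.
    move=> u v; rewrite /f; case: eqP => [ux|_]; case: eqP => [vx|_].
    - by move=> _; apply: val_inj; rewrite ux vx.
    - by move=> vy; have := valP v; rewrite -vy eqxx.
    - by move=> uy; have := valP u; rewrite uy eqxx.
    - by move/val_inj.
  rewrite -(card_imset _ f_inj); apply: subset_leq_card.
  apply/subsetP => _ /imsetP[u ui ->]; move: ui; rewrite inE /f.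
  by case: eqP => [->|_]; rewrite ?(negPf xi) //= orbF.
Qed.

Lemma iso_embeds (K H : sgraph) : iso K H -> embeds H K.
Proof.
case=> f [[g fK gK] f_adj]; exists g; split; first exact: can_inj gK.
by move=> x y; rewrite -{1}(gK x) -{1}(gK y) f_adj.
Qed.

Lemma bags_le_minor (H G : sgraph) (w : nat) :
  minor H G -> bags_le G w -> bags_le H w.
Proof.
case=> S [K [SG SK /iso_embeds HK]] /(bags_le_embeds SG) wS.
apply: (bags_le_embeds HK); elim: SK wS {SG HK} => // {}G {}H x y xy _ IH wG.
exact/IH/bags_le_contract.
Qed.

(** * The three obstructions have path-width at least 3 *)

Definition nbhd (G : sgraph) (T : {set G}) : {set G} :=
  [set v | (v \notin T) && [exists u in T, adj u v]].

Lemma exists_subset_between (T : finType) (A B : {set T}) (t : nat) :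
  A \subset B -> #|A| <= t <= #|B| ->
  exists X : {set T}, [/\ A \subset X, X \subset B & #|X| = t].
Proof.
move=> sAB /andP[At tB]; have [d def_d] : {d | d = t - #|A|} by exists (t - #|A|).
elim: d A sAB At def_d => [|d IH] A sAB At def_d.
  by exists A; split=> //; apply/eqP; rewrite eqn_leq At /= -subn_eq0 -def_d.
have /properP[_ [x xB xA]] : A \proper B by rewrite properEcard sAB; lia.
have [||| X [sX XB cX]] := IH (x |: A).
- by rewrite subUset sub1set xB.
- by rewrite cardsU1 xA; lia.
- by rewrite cardsU1 xA; lia.
by exists X; split=> //; apply: subset_trans sX; apply: subsetUr.
Qed.

(** Read the bags from left to right, and let U m be the set of vertices all of
    whose bags come before bag m.  Stop at the first bag i for which U (i+1) has at
    least t elements, and choose T of size t between U i and U (i+1).  Every outer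
    neighbour of T lies in bag i, and so does every element of T outside U i; as
    there is one, at most w places of the bag remain for the neighbours. *)
Lemma small_nbhd (G : sgraph) (w t : nat) : 0 < t <= #|G| -> bags_le G w ->
  exists T : {set G}, #|T| = t /\ #|nbhd T| <= w.
Proof.
case/andP=> t_gt0 t_le [n [W [[cov_v cov_e conv] le_w]]].
pose U m : {set G} := [set v | [forall j : 'I_n.+1, (v \in W j) ==> (j < m)]].
have Un : t <= #|U n.+1|.
  apply: leq_trans t_le _; rewrite -cardsT; apply: subset_leq_card.
  by apply/subsetP => v _; rewrite inE; apply/forallP => j; rewrite ltn_ord implybT.
have U0 : U 0 = set0.
  apply/setP => v; rewrite !inE; apply/negbTE/forallPn.
  by have [i vi] := cov_v v; exists i; rewrite vi.
have exU : exists m, t <= #|U m| by exists n.+1.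
have [m Um min_m] := ex_minnP exU.
case: m Um min_m => [|i] Um min_m; first by rewrite U0 cards0 in Um; lia.
have le_in : i < n.+1 by exact: min_m.
have Ui : #|U i| <= t.
  by rewrite leqNgt; apply/negP => /ltnW /min_m; rewrite ltnn.
have sU : U i \subset U i.+1.
  apply/subsetP => v; rewrite !inE => /forallP vU; apply/forallP => j.
  by apply/implyP => /(implyP (vU j)) /ltnW.
have [|T [sUT sTU cT]] := exists_subset_between sU (t := t); first by rewrite Ui Um.
exists T; split=> //.
pose I : 'I_n.+1 := Ordinal le_in.
(* Being outside U i, the vertex also has a bag from i on. *)
have inI v (j : 'I_n.+1) : v \notin U i -> v \in W j -> j <= i -> v \in W I.
  rewrite inE => /forallPn[k]; rewrite negb_imply -leqNgt => /andP[vk ik] vj ji.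
  by apply: (subsetP (conv j I k _)); rewrite ?inE ?vj //= ji ik.
have memU v (j : 'I_n.+1) m : v \in U m -> v \in W j -> j < m.
  by rewrite inE => /forallP vU vj; apply: (implyP (vU j)).
have sub : nbhd T :|: (T :\: U i) \subset W I.
  apply/subsetP => v; rewrite 3!inE => /orP[/andP[vT /existsP[u /andP[uT uv]]]|].
    have [j /andP[uj vj]] := cov_e _ _ uv.
    apply: (inI v j) => //; first by apply: contra vT; apply: (subsetP sUT).
    by have := memU u j i.+1 (subsetP sTU _ uT) uj.
  case/andP=> vU vT; have [j vj] := cov_v v.
  by apply: (inI v j) => //; have := memU v j i.+1 (subsetP sTU _ vT) vj.
have T0 : 0 < #|T :\: U i|.
  rewrite lt0n cards_eq0 setD_eq0; apply/negP => /subset_leq_card.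
  rewrite cT => tU; have := min_m i tU; by rewrite ltnn.
have := leq_trans (subset_leq_card sub) (le_w I).
rewrite cardsU (_ : _ :&: _ = set0) ?cards0; first by lia.
by apply/setP => v; rewrite !inE; case: (v \in T); rewrite ?andbF.
Qed.

Fixpoint words (n t : nat) : seq (seq nat) :=
  if t is t'.+1 then [seq x :: l | x <- iota 0 n, l <- words n t'] else [:: [::]].

Lemma mem_words (n t : nat) (l : seq nat) :
  size l = t -> all (fun x => x < n) l -> l \in words n t.
Proof.
elim: t l => [|t IH] [|x l] //= [sz_l] /andP[x_lt l_lt].
by apply: allpairs_f; rewrite ?mem_iota ?IH.
Qed.

(** The condition is written with lists of natural numbers, for which it can be
    evaluated by computation. *)
Definition expands (n t w : nat) (e : seq (nat * nat)) : bool :=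
  let nadj a b := (a != b) && (((a, b) \in e) || ((b, a) \in e)) in
  let out l v := (v \notin l) && has (fun u => nadj u v) l in
  all (fun l => uniq l ==> (w < count (out l) (iota 0 n))) (words n t).

Lemma expands_bags (n t w : nat) (e : seq (nat * nat)) :
  0 < t <= n -> expands n t w e -> ~ bags_le (graph_of_edges n e) w.
Proof.
move=> t_n /allP exp_t /small_nbhd -/(_ t).
rewrite card_ord => /(_ t_n) [T [cT leT]].
pose l : seq nat := [seq val x | x <- enum T].
have := exp_t l; rewrite mem_words ?size_map -?cardE //; last first.
  by apply/allP => _ /mapP[x _ ->]; exact: ltn_ord.
rewrite map_inj_uniq ?enum_uniq; last exact: val_inj.
move=> /(_ isT) /=; apply/negP; rewrite -leqNgt; apply: leq_trans leT.
rewrite -val_enum_ord count_map cardE /nbhd -size_filter eq_leq //.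
rewrite {2}/enum_mem -enumT; congr size; apply: eq_filter => v /=.
have lE (u : graph_of_edges n e) : (val u \in l) = (u \in T).
  by rewrite mem_map ?mem_enum //; exact: val_inj.
rewrite inE lE; congr (_ && _); apply/hasP/existsP.
  by case=> _ /mapP[u uT ->] uv; exists u; rewrite mem_enum in uT; rewrite uT.
by case=> u /andP[uT uv]; exists (val u); rewrite ?lE.
Qed.

(** The set sizes 1, 3, 2 are the ones for which every vertex set has at least
    three outer neighbours. *)
Lemma obstructions_bags :
  [/\ ~ bags_le E1 2, ~ bags_le E2 2 & ~ bags_le E3 2].
Proof.
split.
- by apply: (@expands_bags _ 1) => //; vm_compute.
- by apply: (@expands_bags _ 3) => //; vm_compute.
- by apply: (@expands_bags _ 2) => //; vm_compute.
Qed.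

(** * Sweeps, and tracks have path-width at most 2 *)

Section Sweep.
Variables (G : sgraph) (w : nat).
Implicit Types (D X : {set G}).

Definition front D : {set G} := [set x in D | [exists y, (y \notin D) && adj x y]].

(** A sweep is an ordering of the vertices with vertex separation at most w: the
    front consists of the vertices already added that have neighbours to come. *)
Inductive sweep : {set G} -> Prop :=
| sweep_start : sweep set0
| sweep_add D v : sweep D -> #|front (v |: D)| <= w -> sweep (v |: D).

Lemma sweep_front D : sweep D -> #|front D| <= w.
Proof.
case=> // ; rewrite (_ : front set0 = set0) ?cards0 //.
by apply/setP => x; rewrite !inE.
Qed.

(** A whole set of vertices can be added in any order when no intermediate set
    has a large front. *)
Lemma sweep_extend D X : sweep D -> D \subset X ->
  (forall Y : {set G}, D \subset Y -> Y \subset X -> #|front Y| <= w) -> sweep X.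
Proof.
move=> swD sDX; have [d def_d] : {d | d = #|X :\: D|} by exists #|X :\: D|.
elim: d D swD sDX def_d => [|d IH] D swD sDX def_d smallX.
  have /eqP := esym def_d; rewrite cards_eq0 setD_eq0 => sXD.
  suff -> : X = D by []; by apply/eqP; rewrite eqEsubset sXD.
have /card_gt0P[x] : 0 < #|X :\: D| by rewrite -def_d.
rewrite inE => /andP[xD xX].
have sDX' : x |: D \subset X by rewrite subUset sub1set xX.
apply: (IH (x |: D)) => //.
- by apply: sweep_add => //; apply: smallX; rewrite ?subsetUr.
- apply/eqP; rewrite -eqSS def_d (cardsD1 x (X :\: D)) inE xD xX /= add1n eqSS.
  by apply/eqP; congr #|pred_of_set _|; apply/setP => y; rewrite !inE negb_or andbA.
- by move=> Y sY; apply: smallX; apply: subset_trans sY; apply: subsetUr.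
Qed.

(** Adding v to D creates the bag consisting of v and of the front of D.  It
    contains all neighbours of v in D, and a vertex that misses it never occurs in
    a bag again. *)
Lemma sweep_bags : sweep [set: G] -> bags_le G w.
Proof.
move=> swT.
suff [bs [[bs0 covT] [edgeT _] [conv small]]] :
  exists bs : seq {set G},
    [/\ 0 < size bs /\ (forall v, v \in [set: G] -> exists2 A, A \in bs & v \in A),
        (forall u v, u \in [set: G] -> v \in [set: G] -> adj u v ->
          exists2 A, A \in bs & (u \in A) && (v \in A)) /\
        ({in bs, forall A : {set G}, A \subset [set: G]} /\
         front [set: G] \subset last set0 bs)
      & (forall i j k, i <= j <= k -> k < size bs ->
          nth set0 bs i :&: nth set0 bs k \subset nth set0 bs j) /\
        {in bs, forall A : {set G}, #|A| <= w.+1}].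
  case: bs bs0 covT edgeT conv small => // B bs _ covT edgeT conv small.
  have idx A : A \in B :: bs ->
      exists i : 'I_(size bs).+1, nth set0 (B :: bs) i = A.
    move=> Abs; have lt_i : index A (B :: bs) < (size bs).+1 by rewrite -index_mem in Abs.
    by exists (Ordinal lt_i); exact: nth_index.
  exists (size bs), (fun i => nth set0 (B :: bs) i); split; first split.
  - by move=> v; have [A /idx[i <-] vA] := covT v (in_setT v); exists i.
  - move=> u v uv; have [A /idx[i <-] uvA] := edgeT u v (in_setT u) (in_setT v) uv.
    by exists i.
  - by move=> i j k le_ijk; apply: conv => //; exact: ltn_ord.
  - by move=> i; apply: small; apply: mem_nth; exact: ltn_ord.
elim: {1 2 3 4 5 6}_ / swT =>
  [|D v swD [bs [[bs0 covD] [edgeD [subD lastD]] [conv small]]] frD].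
  (* Starting with an empty bag ensures that there is a last bag. *)
  exists [:: set0]; split; split=> //.
  - by move=> v; rewrite inE.
  - by move=> u v; rewrite inE.
  - split; first by move=> A; rewrite inE => /eqP->.
    by apply/subsetP => x; rewrite !inE.
  - move=> i j k le_ijk lt_k1.
    have [-> -> _] : [/\ i = 0, j = 0 & k = 0] by split; move: lt_k1 => /=; lia.
    exact: subsetIl.
  - by move=> A; rewrite inE => /eqP->; rewrite cards0.
have [vD|vD] := boolP (v \in D).
  have -> : v |: D = D by apply/setP => x; rewrite !inE; case: eqP => // ->.
  by exists bs.
pose B := v |: front D.
have vB : v \in B by rewrite setU11.
exists (rcons bs B); split; split.
- by rewrite size_rcons.
- move=> x; rewrite in_setU1 => /orP[/eqP->|/covD[A Abs xA]].
    by exists B; rewrite ?mem_rcons ?mem_head.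
  by exists A; rewrite ?mem_rcons ?inE ?Abs ?orbT.
- have new x : x \in D -> adj x v -> x \in B.
    move=> xD xv; rewrite !inE xD /=; apply/orP; right; apply/existsP.
    by exists v; rewrite vD.
  move=> x y; rewrite !in_setU1 => /orP[/eqP->|xD] /orP[/eqP->|yD].
  + by rewrite adj_irrefl.
  + by rewrite adj_sym => yv; exists B; rewrite ?mem_rcons ?mem_head // vB new.
  + by move=> xv; exists B; rewrite ?mem_rcons ?mem_head // vB new.
  + move=> xy; have [A Abs xyA] := edgeD x y xD yD xy.
    by exists A; rewrite // mem_rcons inE Abs orbT.
- split.
    move=> A; rewrite mem_rcons inE => /orP[/eqP->|/subD sA].
      by apply: setUS; apply/subsetP => x; rewrite inE => /andP[].
    by apply: subset_trans sA (subsetUr _ _).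
  rewrite last_rcons; apply/subsetP => x; rewrite !inE => /andP[/orP[->//|xD]].
  case/existsP=> y /andP[]; rewrite in_setU1 negb_or => /andP[_ yD] xy.
  by rewrite xD; apply/orP; right; apply/existsP; exists y; rewrite yD.
- move=> i j k /andP[le_ij le_jk]; rewrite size_rcons ltnS leq_eqVlt.
  case/orP=> [/eqP def_k|lt_k]; last first.
    rewrite !nth_rcons lt_k (leq_ltn_trans le_jk lt_k).
    by rewrite (leq_ltn_trans (leq_trans le_ij le_jk) lt_k) conv ?le_ij.
  rewrite !nth_rcons def_k ltnn eqxx; case: (ltnP j) => lt_j; last first.
    have -> : j = size bs by lia.
    by rewrite eqxx; apply: subsetIr.
  rewrite (leq_ltn_trans le_ij lt_j); apply/subsetP => x; rewrite in_setI => /andP[xi xB].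
  have xD : x \in D by apply: (subsetP (subD _ _)) xi; apply: mem_nth; exact: leq_ltn_trans lt_j.
  have xl : x \in nth set0 bs (size bs).-1.
    rewrite nth_last; apply: (subsetP lastD); move: xB; rewrite in_setU1.
    by case/orP=> // /eqP x_v; rewrite -x_v xD in vD.
  by apply: (subsetP (conv i j (size bs).-1 _ _)); rewrite ?inE ?xi //; lia.
- move=> A; rewrite mem_rcons inE => /orP[/eqP->|/small //].
  by rewrite cardsU1 -add1n leq_add ?leq_b1 ?sweep_front.
Qed.

End Sweep.

(** What a sweep uses of a track: R holds for the ends of chords and mid for the
    ends and the middle node of long ones.  The conditions on p and on q mirror each
    other, so that only the advance along p has to be examined. *)
Record ladder (G : sgraph) (k l : nat) (p : 'I_k.+1 -> G) (q : 'I_l.+1 -> G)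
    (R : 'I_k.+1 -> 'I_l.+1 -> Prop) (mid : 'I_k.+1 -> 'I_l.+1 -> G -> Prop) := {
  ladder_noncrossing : forall a b a' b', R a b -> R a' b' -> a < a' -> b <= b';
  ladder_edge_p : forall a w, adj (p a) w ->
    (exists2 a', w = p a' & a' <= a.+1) \/
    (exists2 b, R a b & w = q b \/ mid a b w);
  ladder_edge_q : forall b w, adj (q b) w ->
    (exists2 b', w = q b' & b' <= b.+1) \/
    (exists2 a, R a b & w = p a \/ mid a b w);
  ladder_edge_m : forall a b m w, mid a b m -> adj m w -> w = p a \/ w = q b }.

(** The part of the ladder below p_i and q_j, with the middle nodes of the chords
    inside that part. *)
Definition lower (G : sgraph) (k l : nat) (p : 'I_k.+1 -> G) (q : 'I_l.+1 -> G)
    (mid : 'I_k.+1 -> 'I_l.+1 -> G -> Prop) (i j : nat) : {set G} :=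
  [set v | `[< [\/ exists2 a, v = p a & a <= i, exists2 b, v = q b & b <= j
                 | exists a b, [/\ mid a b v, a <= i & b <= j]] >]].

(** No chord joins a vertex strictly below p_i to one above q_j, nor a vertex
    strictly below q_j to one above p_i; hence only p_i and q_j have chords leading
    ahead. *)
Definition settled (k l : nat) (R : 'I_k.+1 -> 'I_l.+1 -> Prop) (i j : nat) : Prop :=
  forall a b, R a b -> (a < i -> b <= j) /\ (b < j -> a <= i).

Lemma ladder_swap (G : sgraph) k l p q R mid :
  @ladder G k l p q R mid ->
  ladder q p (fun b a => R a b) (fun b a m => mid a b m).
Proof.
case=> Hn Hp Hq Hm; split=> //.
- move=> b a b' a' Rab Rab' lt_b; rewrite leqNgt; apply/negP => /(Hn _ _ _ _ Rab' Rab).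
  by rewrite leqNgt lt_b.
- by move=> b a m w /Hm{}Hm /Hm[]; [right|left].
Qed.

Lemma lower_swap (G : sgraph) k l (p : 'I_k.+1 -> G) (q : 'I_l.+1 -> G) mid i j :
  lower q p (fun b a m => mid a b m) j i = lower p q mid i j.
Proof.
apply/setP => v; rewrite !inE; apply/asboolP/asboolP.
  by case=> [?|?|[b [a [? ? ?]]]]; [constructor 2|constructor 1|constructor 3; exists a, b].
by case=> [?|?|[b [a [? ? ?]]]]; [constructor 2|constructor 1|constructor 3; exists a, b].
Qed.

Lemma settled_swap k l (R : 'I_k.+1 -> 'I_l.+1 -> Prop) i j :
  settled R i j -> settled (fun b a => R a b) j i.
Proof. by move=> set_ij b a /set_ij[]. Qed.

(** Once p_(i+1) has been added, p_i has no neighbour ahead, so the front stays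
    within p_(i+1) and q_j while the middle nodes of chords at p_(i+1) follow. *)
Lemma sweep_step (G : sgraph) k l p q R mid (i : 'I_k.+1) (j : 'I_l.+1) :
    @ladder G k l p q R mid -> i < k -> settled R i j ->
    (forall b, R i b -> b <= j) -> sweep 2 (lower p q mid i j) ->
  settled R i.+1 j /\ sweep 2 (lower p q mid i.+1 j).
Proof.
move=> lad lt_ik set_ij le_j sw; split.
  move=> a b Rab; have [le_b le_a] := set_ij a b Rab.
  split=> [|/le_a/leqW//]; rewrite ltnS leq_eqVlt => /orP[/eqP/val_inj eq_ai|/le_b//].
  by apply: le_j; rewrite -eq_ai.
have lt_i1 : i.+1 < k.+1 by [].
pose v := p (Ordinal lt_i1); pose D := lower p q mid i j.
have small (X : {set G}) : v |: D \subset X -> X \subset lower p q mid i.+1 j ->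
    #|front X| <= 2.
  rewrite subUset sub1set => /andP[vX /subsetP sDX] /subsetP sX.
  have pX (a : 'I_k.+1) : a <= i.+1 -> p a \in X.
    rewrite leq_eqVlt => /orP[/eqP eq_a|lt_a].
      by rewrite (_ : a = Ordinal lt_i1) //; apply: val_inj.
    by apply: sDX; rewrite inE; apply/asboolP; constructor 1; exists a.
  have qX (b : 'I_l.+1) : b <= j -> q b \in X.
    by move=> le_b; apply: sDX; rewrite inE; apply/asboolP; constructor 2; exists b.
  have mX a b m : mid a b m -> a <= i -> b <= j -> m \in X.
    by move=> *; apply: sDX; rewrite inE; apply/asboolP; constructor 3; exists a, b.
  suff sF : front X \subset [set v; q j].
    by apply: leq_trans (subset_leq_card sF) _; rewrite cards2; case: eqP.
  apply/subsetP => x; rewrite !inE => /andP[/sX xX /existsP[y /andP[yX xy]]].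
  move: xX; rewrite inE => /asboolP[[a def_x le_a]|[b def_x le_b]|[a [b [mabx le_a le_b]]]].
  - case: (ltngtP a i.+1) le_a => // [lt_a|eq_a] _; last first.
      by rewrite def_x (_ : a = Ordinal lt_i1) ?eqxx //; apply: val_inj.
    have le_bj b : R a b -> b <= j.
      move=> Rab; move: lt_a; rewrite ltnS leq_eqVlt => /orP[/eqP eq_ai|lt_a];
        last by have [->] := set_ij a b Rab.
      by apply: le_j; rewrite (_ : i = a) //; apply: val_inj.
    case/negP: yX; rewrite def_x in xy.
    have [[a' -> le_a']|[b Rab [->|maby]]] := ladder_edge_p lad xy.
    + by apply: pX; apply: leq_trans le_a' _.
    + exact/qX/le_bj.
    + by apply: mX maby _ _; rewrite ?le_bj.
  - case: (ltngtP b j) le_b => // [lt_b|eq_b] _; last first.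
      by rewrite def_x (_ : b = j) ?eqxx ?orbT //; apply: val_inj.
    case/negP: yX; rewrite def_x in xy.
    have [[b' -> le_b']|[a Rab [->|maby]]] := ladder_edge_q lad xy.
    + by apply: qX; apply: leq_trans le_b' _.
    + by apply/pX/leqW; have [_ ->] := set_ij a b Rab.
    + by apply: mX maby _ _; rewrite ?(ltnW lt_b) //; have [_ ->] := set_ij a b Rab.
  - by case/negP: yX; have [->|->] := ladder_edge_m lad mabx xy; rewrite ?pX ?qX.
have sD' : v |: D \subset lower p q mid i.+1 j.
  apply/subsetP => x; rewrite in_setU1 => /orP[/eqP->|].
    by rewrite inE; apply/asboolP; constructor 1; exists (Ordinal lt_i1).
  rewrite !inE => /asboolP H; apply/asboolP.
  case: H => [[a ? ?]|[b ? ?]|[a [b [? ? ?]]]]; [constructor 1|constructor 2|constructor 3].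
  - by exists a => //; apply: leqW.
  - by exists b.
  - by exists a, b; split=> //; apply: leqW.
apply: (sweep_extend _ sD' small); apply: sweep_add => //.
by apply: small; rewrite ?subxx.
Qed.

(** If a chord leads from p_i ahead of q_j then by noncrossing no chord leads
    from q_j ahead of p_i, and the sweep can advance along q; otherwise it can advance
    along p. *)
Lemma ladder_sweep (G : sgraph) k l p q R mid :
  @ladder G k l p q R mid -> sweep 2 (lower p q mid k l).
Proof.
move=> lad.
have sw0 : sweep 2 (lower p q mid 0 0).
  have sD0 : [set p ord0; q ord0] \subset lower p q mid 0 0.
    apply/subsetP => x; rewrite !inE => /orP[] /eqP->; apply/asboolP.
      by constructor 1; exists ord0.
    by constructor 2; exists ord0.
  have small2 (X : {set G}) : X \subset [set p ord0; q ord0] -> #|front X| <= 2.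
    move=> sX; apply: (@leq_trans #|[set p ord0; q ord0]|); last first.
      by rewrite cards2; case: eqP.
    apply: subset_leq_card; apply: subset_trans sX.
    by apply/subsetP => x; rewrite inE => /andP[].
  apply: (sweep_extend _ sD0).
    by apply: (sweep_extend (sweep_start _ _) (sub0set _)) => X _; apply: small2.
  move=> X sX /subsetP sX'; apply: leq_trans (_ : #|[set p ord0; q ord0]| <= 2); last first.
    by rewrite cards2; case: eqP.
  have [pX qX] : p ord0 \in X /\ q ord0 \in X.
    by split; apply: (subsetP sX); rewrite !inE eqxx ?orbT.
  have le0 n (a : 'I_n.+1) : a <= 0 -> a = ord0.
    by rewrite leqn0 => /eqP a0; apply: val_inj.
  apply: subset_leq_card; apply/subsetP => x.
  rewrite !inE => /andP[/sX' + /existsP[y /andP[yX xy]]]; rewrite inE.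
  case/asboolP => [[a -> /le0->]|[b -> /le0->]|[a [b [mabx /le0 a0 /le0 b0]]]].
  - by rewrite eqxx.
  - by rewrite eqxx orbT.
  - case/negP: yX; have [->|->] := ladder_edge_m lad mabx xy; by rewrite ?a0 ?b0.
suff walk n : n <= k + l -> exists (i : 'I_k.+1) (j : 'I_l.+1),
    [/\ i + j = n, settled R i j & sweep 2 (lower p q mid i j)].
  have [i [j [eq_ij _]]] := walk _ (leqnn _).
  have [-> -> //] : (i : nat) = k /\ (j : nat) = l.
  by have := ltn_ord i; have := ltn_ord j; lia.
elim: n => [|n IH] le_n.
  by exists ord0, ord0; split.
have [i [j [def_n set_ij sw]]] := IH (ltnW le_n).
have stepP : i < k -> (forall b, R i b -> b <= j) -> exists (i : 'I_k.+1) (j : 'I_l.+1),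
    [/\ i + j = n.+1, settled R i j & sweep 2 (lower p q mid i j)].
  move=> lt_i le_j; have [set' sw'] := sweep_step lad lt_i set_ij le_j sw.
  have lt_i1 : i.+1 < k.+1 by [].
  by exists (Ordinal lt_i1), j; split=> //=; rewrite addSn def_n.
have stepQ : j < l -> (forall a, R a j -> a <= i) -> exists (i : 'I_k.+1) (j : 'I_l.+1),
    [/\ i + j = n.+1, settled R i j & sweep 2 (lower p q mid i j)].
  move=> lt_j le_i; rewrite -lower_swap in sw.
  have [set' sw'] := sweep_step (ladder_swap lad) lt_j (settled_swap set_ij) le_i sw.
  have lt_j1 : j.+1 < l.+1 by [].
  exists i, (Ordinal lt_j1); split=> //=; first by rewrite addnS def_n.
    exact: settled_swap set'.
  by rewrite -lower_swap.
have [[b Rib lt_b]|noR] := EM (exists2 b, R i b & j < b).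
  apply: stepQ => [|a Raj]; first by apply: leq_trans lt_b _; rewrite -ltnS.
  rewrite leqNgt; apply/negP => /(ladder_noncrossing lad Rib Raj).
  by rewrite leqNgt lt_b.
have [lt_i|le_k] := ltnP i k.
  apply: stepP => // b Rib; rewrite leqNgt; apply/negP => lt_b.
  by apply: noR; exists b.
apply: stepQ; first by lia.
by move=> a _; apply: leq_trans le_k; rewrite -ltnS.
Qed.

Lemma noncrossing_nat (a a' b b' : nat) :
  reflect ((a < a' -> b <= b') /\ (a' < a -> b' <= b))
    (0 <= (a%:Z - a'%:Z) * (b%:Z - b'%:Z))%R.
Proof.
apply: (iffP idP) => [ge0|[le le']]; first by split=> *; nia.
case: (ltngtP a a') => [/le|/le'|->]; nia.
Qed.

(** Middle nodes have degree 2 and so have no neighbours besides the two ends of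
    their chord; the covering condition accounts for the neighbours of path vertices. *)
Lemma track_bags2 (G : sgraph) : track G -> bags_le G 2.
Proof.
case=> _ [k [l [p [q [C [[[p_inj p_adj] [q_inj q_adj] pq] isC nonC _ [covV covE]]]]]]].
pose R a b := connected_by_chord C a b.
pose mid a b m := (a, b, Some m) \in C.
have set2P (u v x y : G) : [set u; v] = [set x; y] ->
    (u = x /\ v = y) \/ (u = y /\ v = x).
  move=> /setP E; have := E u; have := E v; have := E x; have := E y.
  rewrite !inE !eqxx ?orbT /= => /orP[] /eqP yE /orP[] /eqP xE;
    by move=> /esym/orP[] /eqP vE /esym/orP[] /eqP uE; subst; auto.
have lad : ladder p q R mid.
  split.
  - move=> a b a' b' [o Cab] [o' Cab'] lt_a.
    by have /noncrossing_nat[+ _] := nonC _ _ Cab Cab'; apply.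
  - move=> a w aw; have [[x [y [eq_y /set2P[]]]]|[x [y [eq_y /set2P[]]]]|] := covE _ _ aw.
    + by case=> /p_inj-> ->; left; exists y; rewrite ?eq_y.
    + by case=> /p_inj-> ->; left; exists x => //; rewrite eq_y ltnW // ltnW.
    + by case=> /pq.
    + by case=> /pq.
    + case=> [[[x y] [m|]]] Cxy /=; last first.
        case/set2P=> -[]; last by move/pq.
        by move/p_inj=> -> ->; right; exists y; [exists None|left].
      have [_ _ _ mp mq] := isC _ Cxy.
      case=> /set2P[] [].
      * by move/p_inj=> -> ->; right; exists y; [exists (Some m)|right].
      * by move/esym/mp.
      * by move/esym/mp.
      * by move/pq.
  - move=> a w aw; have [[x [y [eq_y /set2P[]]]]|[x [y [eq_y /set2P[]]]]|] := covE _ _ aw.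
    + by case=> /esym/pq.
    + by case=> /esym/pq.
    + by case=> /q_inj-> ->; left; exists y; rewrite ?eq_y.
    + by case=> /q_inj-> ->; left; exists x => //; rewrite eq_y ltnW // ltnW.
    + case=> [[[x y] [m|]]] Cxy /=; last first.
        case/set2P=> -[]; first by move/esym/pq.
        by move/q_inj=> -> ->; right; exists x; [exists None|left].
      have [_ _ _ mp mq] := isC _ Cxy.
      case=> /set2P[] [].
      * by move/esym/pq.
      * by move/esym/mq.
      * by move/esym/mq.
      * by move/q_inj=> -> ->; right; exists x; [exists (Some m)|right].
  - move=> a b m w mab mw; have [pm mq deg _ _] := isC _ mab.
    have sub : [set p a; q b] \subset [set y | adj m y].
      by apply/subsetP => x; rewrite !inE => /orP[] /eqP-> //; rewrite adj_sym.
    have eqN : [set p a; q b] = [set y | adj m y].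
      apply/eqP; rewrite eqEcard sub /= -/(degree m) deg cards2.
      by case: eqP => // /pq.
    by have := in_set (fun y => adj m y) w; rewrite -eqN mw !inE => /orP[] /eqP; auto.
have := ladder_sweep lad; rewrite (_ : lower _ _ _ _ _ = setT); first exact: sweep_bags.
apply/setP => v; rewrite !inE; apply/asboolP.
have [[a ->]|[b ->]|[a [b Cab]]] := covV v.
- by constructor 1; exists a => //; rewrite -ltnS.
- by constructor 2; exists b => //; rewrite -ltnS.
- by constructor 3; exists a, b; split=> //; rewrite -ltnS.
Qed.

(** * Minors from branch sets *)

(** Contract edges inside fibers until f is injective.  The last two conditions
    make f an isomorphism at that point, and a contraction preserves them. *)
Lemma contracts_to_fibers (S H : sgraph) (f : S -> H) :
    (forall h, exists x, f x = h) ->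
    (forall x y, f x = f y -> connect (fun u v => adj u v && (f u == f v)) x y) ->
    (forall x y, f x != f y -> adj x y -> adj (f x) (f y)) ->
    (forall h h', adj h h' -> exists x y, [/\ f x = h, f y = h' & adj x y]) ->
  exists2 K, contracts_to S K & iso K H.
Proof.
have [n le_n] := ubnP #|S|; elim: n S le_n f => // n IH S le_n f f_surj f_conn f_adj f_edge.
have [f_inj|] := EM (injective f).
  exists S; first exact: contracts_refl.
  exists f; split.
    have [g fK] : exists g, cancel g f 
      by exists (fun h => sval (cid (f_surj h))) => h; exact: svalP (cid (f_surj h)).
    by exists g => // x; apply: f_inj; rewrite fK.
  move=> x y; apply/idP/idP => [/f_edge[x' [y' [/f_inj-> /f_inj->]]] //|xy].
  apply: f_adj => //; apply: contraTneq xy => /f_inj->.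
  by rewrite adj_irrefl.
move=> not_inj.
have [x [y [fxy xy]]] : exists x y, f x = f y /\ adj x y.
  apply: contrapT => no_edge; apply: not_inj => x y fxy; apply: contrapT => neq_xy.
  case/connectP: (f_conn x y fxy) => [[|z s]] /=; first by move=> _ /esym.
  by case/andP=> /andP[xz /eqP fxz] _ _; apply: no_edge; exists x, z.
have neq_xy : x != y by apply: contraTneq xy => ->; rewrite adj_irrefl.
pose x' : contract x y := Sub x neq_xy.
pose g (u : contract x y) := f (val u).
pose r (u : S) : contract x y := insubd x' u.
have rE u : val (r u) = if u == y then x else u.
  by rewrite val_insubd; case: eqP.
have gr u : g (r u) = f u by rewrite /g rE; case: eqP => // ->.
have radj u v : adj u v -> r u != r v -> adj (r u) (r v).
  move=> uv neq_uv; rewrite /= /contract_adj neq_uv /= !rE.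
  case: (u =P y) uv => [->|_]; case: (v =P y) => [->|_] uv; rewrite ?eqxx ?uv ?orbT //.
    by rewrite adj_irrefl in uv.
  by rewrite [adj y u]adj_sym uv !orbT.
have rK (u : contract x y) : r (val u) = u by rewrite /r valKd.
have [||||| K ctK isoK] := IH (contract x y) _ g.
- have S_gt0 : 0 < #|S| by apply/card_gt0P; exists y.
  rewrite -ltnS; apply: leq_ltn_trans le_n.
  by rewrite card_sig (eq_card (B := predC1 y)) // cardC1 prednK.
- by move=> h; have [u <-] := f_surj h; exists (r u).
- move=> u v guv; case/connectP: (f_conn _ _ guv) => s pth lst.
  rewrite -(rK u) -(rK v) lst; elim: s (val u) pth {lst} => [|w s IHs] z /=.
    by move=> _; exact: connect0.
  case/andP=> /andP[zw fzw] /IHs; apply: connect_trans.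
  have [->|neq] := eqVneq (r z) (r w); first exact: connect0.
  by apply: connect1; rewrite !gr fzw radj.
- move=> u v guv; rewrite /= /contract_adj.
  case/andP=> _ /or3P[|/andP[/eqP ux yv]|/andP[/eqP vx yu]].
  + exact: f_adj.
  + by rewrite /g ux fxy; apply: f_adj => //; rewrite -fxy -ux.
  + by rewrite /g vx fxy adj_sym; apply: f_adj => //; rewrite -fxy -vx eq_sym.
- move=> h h' hh'; have [u [v [fu fv uv]]] := f_edge h h' hh'.
  exists (r u), (r v); rewrite !gr; split=> //; apply: radj => //.
  by apply: contraTneq hh' => ruv; rewrite -fu -fv -(gr u) ruv gr adj_irrefl.
by exists K => //; apply: contracts_step ctK.
Qed.

Definition touch (G : sgraph) (A B : seq G) : bool := has (fun x => has (adj x) B) A.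

Arguments touch {G} A B : simpl never.

Lemma touchP (G : sgraph) (A B : seq G) :
  reflect (exists x y, [/\ x \in A, y \in B & adj x y]) (touch A B).
Proof.
apply: (iffP hasP) => [[x xA /hasP[y yB xy]]|[x [y [xA yB xy]]]].
  by exists x, y.
by exists x => //; apply/hasP; exists y.
Qed.

Lemma touch_sym (G : sgraph) (A B : seq G) : touch A B = touch B A.
Proof.
by apply/touchP/touchP => -[x [y [xA yB xy]]]; exists y, x; rewrite adj_sym.
Qed.

Lemma touch_catl (G : sgraph) (A A' B : seq G) : touch (A ++ A') B = touch A B || touch A' B.
Proof. exact: has_cat. Qed.

Lemma touch_last (G : sgraph) (x y : G) (A B : seq G) :
  adj (last x A) y -> touch (x :: A) (y :: B).
Proof.
move=> xy; apply/touchP; exists (last x A), y; split=> //; last exact: mem_head.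
exact: mem_last.
Qed.

(** Branch sets are given as nonempty paths, which makes their connectivity
    part of the data. *)
Definition segment (G : sgraph) (A : seq G) : bool :=
  if A is x :: A' then path adj x A' else false.

(** In the subgraph to be contracted, the only edges kept are those inside a branch
    set or between branch sets of adjacent vertices; otherwise the result might have
    more edges than wanted. *)
Lemma minor_of_segments (G : sgraph) (n : nat) (e : seq (nat * nat)) (Bs : seq (seq G)) :
    size Bs = n -> uniq (flatten Bs) -> all (@segment G) Bs ->
    all (fun ij => touch (nth [::] Bs ij.1) (nth [::] Bs ij.2)) e ->
  minor (graph_of_edges n e) G.
Proof.
move=> sz_Bs uniq_Bs /allP seg_Bs /allP touch_Bs.
pose H := graph_of_edges n e.
pose B (h : H) := nth [::] Bs h.
have Bin h : B h \in Bs by apply: mem_nth; rewrite sz_Bs; exact: ltn_ord.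
have Bdis h h' x : x \in B h -> x \in B h' -> h = h'.
  move=> xh xh'; apply: val_inj => /=.
  wlog lt_h : h h' xh xh' / h < h'.
    by move=> W; case: (ltngtP h h') => // lt_h; [exact: W | exact/esym/W].
  move: uniq_Bs; rewrite -(cat_take_drop h' Bs) flatten_cat cat_uniq => /and3P[_ /hasPn H0 _].
  have := H0 x.
  have lt_n : h' < size Bs by rewrite sz_Bs; exact: ltn_ord.
  have -> : x \in flatten (drop h' Bs).
    by apply/flattenP; exists (B h') => //; rewrite (drop_nth [::]) // mem_head.
  case/(_ isT)/negP; apply/flattenP; exists (B h) => //.
  by rewrite /B -(nth_take [::] lt_h) mem_nth // size_takel // ltnW.
pose U := flatten Bs; pose T := {x : G | x \in U}.
have inU h x : x \in B h -> x \in U by move=> xh; apply/flattenP; exists (B h).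
have ex_h (x : T) : exists h, val x \in B h.
  have /flattenP[A /(nthP [::])[i lt_i <-] xi] := valP x.
  by rewrite sz_Bs in lt_i; exists (Ordinal lt_i).
pose f (x : T) : H := sval (cid (ex_h x)).
have fP x h : (val x \in B h) = (f x == h).
  have xf : val x \in B (f x) := svalP (cid (ex_h x)).
  by apply/idP/eqP => [/(Bdis _ _ _ xf)|<-].
pose R (x y : T) := adj (val x) (val y) && ((f x == f y) || adj (f x) (f y)).
have R_sym : symmetric R by move=> x y; rewrite /R adj_sym eq_sym [adj (f x) _]adj_sym.
have R_irr : irreflexive R by move=> x; rewrite /R adj_irrefl.
pose S := SGraph R_sym R_irr.
have edge h h' : adj h h' -> touch (B h) (B h').
  rewrite /= /edges_adj => /andP[_ /orP[]] /touch_Bs //=.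
  by rewrite touch_sym.
have [|||h h' hh'|K SK isoK] := @contracts_to_fibers S H f.
- move=> h; have := seg_Bs _ (Bin h); case def_B : (B h) => [|x A] //= _.
  have xU : x \in U by apply: (inU h); rewrite def_B mem_head.
  by exists (Sub x xU); apply/eqP; rewrite -fP /= def_B mem_head.
- move=> x y fxy; pose r (u : G) : T := insubd x u.
  have rK (u : T) : r (val u) = u by rewrite /r valKd.
  pose E (u v : S) := adj u v && (f u == f v).
  have E_sym : symmetric E by move=> u v; rewrite /E adj_sym eq_sym.
  have := seg_Bs _ (Bin (f x)); case def_B : (B (f x)) => [|z A] //= pthA.
  suff conn u : u \in z :: A -> connect E (r z) (r u).
    rewrite -(rK x) -(rK y); apply: connect_trans (r z) _ _ _ _.
      by rewrite sym_connect_sym // conn // -def_B fP.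
    by rewrite conn // -def_B fP fxy.
  have memB (v : G) : v \in z :: A -> val (r v) = v /\ f (r v) = f x.
    rewrite -def_B => vB; have vU := inU _ _ vB.
    have rv : val (r v) = v by rewrite val_insubd vU.
    by split=> //; apply/eqP; rewrite -fP rv.
  move=> uA; have pthR : path E (r z) (map r A).
    elim: A z pthA memB {def_B uA} => //= a A IHA b /andP[ba pthA] memB.
    have [[vb fb] [va fa]] : (val (r b) = b /\ f (r b) = f x) /\
        (val (r a) = a /\ f (r a) = f x).
      by split; apply: memB; rewrite ?in_cons ?eqxx ?orbT.
    have -> : E (r b) (r a).
      rewrite /E fb fa eqxx andbT; apply/andP; split; first by rewrite va vb.
      by rewrite fb fa eqxx.
    rewrite /=; apply: IHA => // v vA.
    by apply: memB; rewrite inE vA orbT.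
  by apply: (path_connect pthR); rewrite -map_cons map_f.
- move=> x y neq_f; rewrite /= /R => /andP[_]; by rewrite (negPf neq_f).
- have /touchP[x [y [xB yB xy]]] := edge _ _ hh'.
  exists (Sub x (inU _ _ xB)), (Sub y (inU _ _ yB)).
  have fx : f (Sub x (inU _ _ xB)) = h by apply/eqP; rewrite -fP.
  have fy : f (Sub y (inU _ _ yB)) = h' by apply/eqP; rewrite -fP.
  by split=> //; rewrite /= /R fx fy hh' orbT andbT.
by exists S, K; split=> //; exists val; split=> [|x y /andP[]//]; exact: val_inj.
Qed.

(** * Subgraphs with a minor among the three obstructions *)

Lemma touch_catr (G : sgraph) (A B B' : seq G) : touch A (B ++ B') = touch A B || touch A B'.
Proof. by rewrite touch_sym touch_catl !(touch_sym A). Qed.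

Lemma touch_ear (G : sgraph) (x y : G) (A t B : seq G) :
  x \in A -> path adj x (rcons t y) -> touch A (t ++ y :: B).
Proof.
move=> xA; case: t => [|z t] /= /andP[xz _]; apply/touchP.
  by exists x, y; rewrite mem_head.
by exists x, z; rewrite mem_head.
Qed.

Lemma path_cat_cons (T : Type) (e : rel T) (x y : T) (A B : seq T) :
  path e x (A ++ y :: B) = [&& path e x A, e (last x A) y & path e y B].
Proof. by rewrite cat_path. Qed.

Lemma last_cat_cons (T : Type) (x y : T) (A B : seq T) :
  last x (A ++ y :: B) = last y B.
Proof. by rewrite last_cat. Qed.

Lemma segment_ear (G : sgraph) (x y : G) (t B : seq G) :
  path adj x (rcons t y) -> path adj y B -> segment (t ++ y :: B).
Proof.
case: t => //= z t /andP[_]; rewrite rcons_path path_cat_cons.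
by case/andP=> -> ->.
Qed.

(** The branch sets are x and the three arcs starting at a, b, c. *)
Lemma K4_hub (G : sgraph) (x a b c : G) (s1 s2 s3 : seq G) :
    cycle adj (a :: s1 ++ b :: s2 ++ c :: s3) ->
    uniq (x :: a :: s1 ++ b :: s2 ++ c :: s3) ->
  adj x a -> adj x b -> adj x c -> minor E1 G.
Proof.
rewrite /= rcons_path !path_cat_cons !last_cat_cons.
case/andP=> /and5P[pa ab pb bc pc] ca Us xa xb xc.
apply: (@minor_of_segments G 4 _ [:: [:: x]; a :: s1; b :: s2; c :: s3]) => //.
- by rewrite /= cats0 -?cat_cons.
- by rewrite /= pa pb pc.
by rewrite /= [touch (a :: s1) (c :: s3)]touch_sym !touch_last.
Qed.

(** The branch sets are the four arcs starting at a, b, c, d, where the inner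
    vertices of the crossing paths are added to the arcs of c and of d. *)
Lemma K4_cross (G : sgraph) (a b c d : G) (s1 s2 s3 s4 t1 t2 : seq G) :
    cycle adj (a :: s1 ++ b :: s2 ++ c :: s3 ++ d :: s4) ->
    uniq (t1 ++ t2 ++ a :: s1 ++ b :: s2 ++ c :: s3 ++ d :: s4) ->
    path adj a (rcons t1 c) -> path adj b (rcons t2 d) ->
  minor E1 G.
Proof.
rewrite /= rcons_path !path_cat_cons !last_cat_cons.
case/andP=> /and5P[pa ab pb bc /and3P[pc cd pd]] da Us ac bd.
apply: (@minor_of_segments G 4 _
  [:: a :: s1; b :: s2; t1 ++ c :: s3; t2 ++ d :: s4]) => //.
- rewrite (perm_uniq (s2 := t1 ++ t2 ++ a :: s1 ++ b :: s2 ++ c :: s3 ++ d :: s4)) //.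
  by apply/permP => P; do ?rewrite /= count_cat; rewrite /=; clear -s1 s2 s3 s4 t1 t2; lia.
- by rewrite /= pa pb (segment_ear ac pc) (segment_ear bd pd).
rewrite /= touch_last // (touch_ear _ (mem_head _ _) ac) (touch_ear _ (mem_head _ _) bd).
rewrite [touch _ (t2 ++ _)]touch_sym !touch_catl !touch_catr.
by rewrite [touch (b :: s2) (c :: s3)]touch_last // [touch (d :: s4) (a :: s1)]touch_last //
  [touch (c :: s3) (d :: s4)]touch_last ?orbT.
Qed.

(** Besides u and v, the branch sets are the first inner vertex of each path and the
    rest of its inner vertices. *)
Lemma theta_E2 (G : sgraph) (u v : G) (s1 s2 s3 : seq G) :
    [&& path adj u (rcons s1 v), path adj u (rcons s2 v) & path adj u (rcons s3 v)] ->
    uniq (u :: v :: s1 ++ s2 ++ s3) ->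
    1 < size s1 -> 1 < size s2 -> 1 < size s3 ->
  minor E2 G.
Proof.
case: s1 s2 s3 => [|x1 [|y1 s1]] // [|x2 [|y2 s2]] // [|x3 [|y3 s3]] //.
rewrite /= !rcons_path.
case/and3P=> /and4P[ux1 xy1 p1 l1] /and4P[ux2 xy2 p2 l2] /and4P[ux3 xy3 p3 l3] Us _ _ _.
apply: (@minor_of_segments G 8 _
  [:: [:: u]; [:: v]; [:: x1]; y1 :: s1; [:: x2]; y2 :: s2; [:: x3]; y3 :: s3]) => //.
- by rewrite /= cats0.
- by rewrite /= p1 p2 p3.
by rewrite /= !touch_last.
Qed.

(** The arcs starting at the x_i become the triangle, whose edges come from the paths
    t_i, and the arcs starting at the y_i become the three outer vertices. *)
Lemma cycle_E3 (G : sgraph) (x1 x2 x3 y1 y2 y3 : G) (A1 A2 A3 B1 B2 B3 t1 t2 t3 : seq G) :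
    let s := (x1 :: A1) ++ (y1 :: B1) ++ (x2 :: A2) ++ (y2 :: B2) ++ (x3 :: A3) ++ y3 :: B3 in
    cycle adj s -> uniq (t1 ++ t2 ++ t3 ++ s) ->
    path adj (last x1 A1) (rcons t1 x2) -> path adj (last x2 A2) (rcons t2 x3) ->
    path adj (last x3 A3) (rcons t3 x1) ->
  minor E3 G.
Proof.
move=> s; rewrite {}/s /= rcons_path !path_cat_cons !last_cat_cons.
case/andP=> /and5P[pA1 xy1 pB1 yx1 /and5P[pA2 xy2 pB2 yx2 /and3P[pA3 xy3 pB3]]] yx3 Us e1 e2 e3.
apply: (@minor_of_segments G 6 _
  [:: (x1 :: A1) ++ t1; (x2 :: A2) ++ t2; (x3 :: A3) ++ t3;
      y1 :: B1; y2 :: B2; y3 :: B3]) => //.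
- rewrite (perm_uniq (s2 := t1 ++ t2 ++ t3 ++ x1 :: A1 ++ y1 :: B1 ++
    x2 :: A2 ++ y2 :: B2 ++ x3 :: A3 ++ y3 :: B3)) //.
  apply/permP => P; do ?rewrite /= count_cat; rewrite /=.
  by clear -A1 A2 A3 B1 B2 B3 t1 t2 t3; lia.
- move: e1 e2 e3; rewrite !rcons_path /= !cat_path pA1 pA2 pA3 pB1 pB2 pB3.
  by case/andP=> -> _ /andP[-> _] /andP[-> _].
move: e1 e2 e3; rewrite !rcons_path => /andP[_ e1] /andP[_ e2] /andP[_ e3].
have T x y (A t B t' : seq G) : adj (last (last x A) t) y ->
    touch ((x :: A) ++ t) ((y :: B) ++ t').
  by move=> lxy; rewrite touch_last // last_cat.
have T' x y (A t B : seq G) : adj (last x A) y -> touch (y :: B) ((x :: A) ++ t).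
  by move=> lxy; rewrite touch_sym touch_catl touch_last.
have T'' x y (A t B : seq G) : adj (last x A) y -> touch (x :: A) ((y :: B) ++ t).
  by move=> lxy; rewrite touch_catr touch_last.
rewrite /= -!cat_cons !T //.
by rewrite (T' _ _ _ _ _ xy1) (T' _ _ _ _ _ xy2) (T' _ _ _ _ _ xy3)
  (T'' _ _ _ _ _ yx1) (T'' _ _ _ _ _ yx2) (T'' _ _ _ _ _ yx3).
Qed.

(** * Longest cycles of 2-connected graphs *)

Lemma third_vertex (G : sgraph) (a b : G) : 3 <= #|G| -> exists c, c != a /\ c != b.
Proof.
move=> G3; have /card_gt0P[c] : 0 < #|~: [set a; b]|.
  by have := cardsC [set a; b]; rewrite cards2; move: G3; case: (a != b); lia.
by rewrite !inE negb_or => /andP[ca cb]; exists c.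
Qed.

(** The form in which 2-connectivity is used: a set of vertices cannot be separated
    from the rest by a single vertex v. *)
Lemma crossing_edge (G : sgraph) (K : {set G}) (x y v : G) :
    two_connected G -> x \in K -> y \notin K -> v \notin K -> y != v ->
  exists a b, [/\ a \in K, b \notin K, b != v & adj a b].
Proof.
case=> _ _ /(_ v)[_ conn_v] xK yK vK yv.
have xv : x != v by apply: contraNneq vK => <-.
have /connectP[s pth lst] := conn_v (Sub x xv) (Sub y yv).
have {}xK : val (Sub x xv : del_vertex v) \in K by [].
have: val (last (Sub x xv : del_vertex v) s) \notin K by rewrite -lst.
elim: s (Sub x xv : del_vertex v) pth xK {lst} => [|w s IH] z /=; first by move=> _ ->.
case/andP=> zw pth zK; have [wK|wK] := boolP (val w \in K); first exact: IH.
by exists (val z), (val w); split=> //; exact: valP w.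
Qed.

Lemma other_nbr (G : sgraph) (x v : G) :
  two_connected G -> v != x -> exists2 b, adj x b & b != v.
Proof.
move=> G2 vx; have [|y [yx yv]] := third_vertex x v; first by case: G2.
have [||||a [b [+ _ bv ab]]] := @crossing_edge G [set x] x y v G2; rewrite ?inE //.
by move/eqP=> ax; exists b; rewrite -?ax.
Qed.

Definition is_cycle (G : sgraph) (s : seq G) : bool :=
  [&& cycle adj s, uniq s & 2 < size s].

Definition longest_cycle (G : sgraph) (s : seq G) : Prop :=
  is_cycle s /\ forall s' : seq G, is_cycle s' -> size s' <= size s.

(** Two neighbours of a vertex x are joined by a path that avoids x. *)
Lemma exists_cycle (G : sgraph) : two_connected G -> exists s : seq G, is_cycle s.
Proof.
move=> G2; have [G3 _ conn] := G2.
have /card_gt0P[x _] : 0 < #|G| by exact: leq_trans G3.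
have [z [zx _]] := third_vertex x x G3.
have [b xb _] := other_nbr G2 zx.
have adj_neq u v : adj u v -> v != u :> G by apply: contraTneq => ->; rewrite adj_irrefl.
have [c xc cb] := other_nbr G2 (adj_neq _ _ xb).
have [_ /(_ (Sub b (adj_neq _ _ xb)) (Sub c (adj_neq _ _ xc)))] := conn x.
case/connectP=> s0 /shortenP[s pth uniq_s _] {s0} lst.
have pth' : path adj b (map val s).
  have -> : b = val (Sub b (adj_neq _ _ xb) : del_vertex x) by [].
  elim: s (Sub b _ : del_vertex x) pth {uniq_s lst} => //= w s IH y /andP[yw pth].
  by apply/andP; split=> //; apply: IH.
exists (x :: b :: map val s); apply/and3P; split.
- rewrite /= rcons_path xb pth' /=.
  have /= := congr1 val lst; rewrite -last_map /= => <-.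
  by rewrite adj_sym.
- have : uniq (map val (Sub b (adj_neq _ _ xb) :: s)) by rewrite map_inj_uniq //; exact: val_inj.
  move=> /= ->; rewrite inE negb_or eq_sym adj_neq //= andbT.
  by apply/mapP => -[y _ def_x]; have /= := valP y; rewrite -[sval y]def_x eqxx.
- case: s lst {pth uniq_s pth'} => //= /(congr1 val) /= eq_cb.
  by rewrite eq_cb eqxx in cb.
Qed.

Lemma exists_longest (G : sgraph) : two_connected G -> exists s : seq G, longest_cycle s.
Proof.
move=> /exists_cycle[s0 cyc0].
have exC : exists n, `[< exists2 s : seq G, is_cycle s & size s = n >].
  by exists (size s0); apply/asboolP; exists s0.
have leC n : `[< exists2 s : seq G, is_cycle s & size s = n >] -> n <= #|G|.
  by case/asboolP=> s /and3P[_ /card_uniqP <- _] <-; exact: max_card.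
case: (ex_maxnP exC leC) => n /asboolP[s cyc_s sz_s] max_n.
by exists s; split=> // s' cyc'; rewrite sz_s; apply: max_n; apply/asboolP; exists s'.
Qed.

Lemma longest_rot (G : sgraph) (n : nat) (s : seq G) :
  longest_cycle s -> longest_cycle (rot n s).
Proof.
by rewrite /longest_cycle /is_cycle rot_cycle rot_uniq size_rot.
Qed.

(** The list t consists of the inner vertices only; it is empty for an edge. *)
Definition ear (G : sgraph) (s : seq G) (u v : G) (t : seq G) : bool :=
  [&& path adj u (rcons t v), uniq t & ~~ has (mem s) t].

Lemma path_rev (G : sgraph) (u v : G) (t : seq G) :
  path adj u (rcons t v) -> path adj v (rcons (rev t) u).
Proof.
rewrite -rev_path last_rcons belast_rcons rev_cons.
by rewrite (eq_path (e' := adj)) // => x y; exact: adj_sym.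
Qed.

Lemma ear_rev (G : sgraph) (s t : seq G) (u v : G) :
  ear s u v t -> ear s v u (rev t).
Proof.
by case/and3P=> /path_rev pth U D; apply/and3P; rewrite rev_uniq has_rev.
Qed.

Lemma ear_rot (G : sgraph) (n : nat) (s t : seq G) (u v : G) :
  ear (rot n s) u v t = ear s u v t.
Proof.
by rewrite /ear; congr [&& _, _ & ~~ _]; apply: eq_has => x; rewrite /= mem_rot.
Qed.

(** Otherwise replacing the arc s1 by t would give a longer cycle. *)
Lemma longest_ear (G : sgraph) (u v : G) (s1 s2 t : seq G) :
    longest_cycle (u :: s1 ++ v :: s2) -> ear (u :: s1 ++ v :: s2) u v t ->
  size t <= size s1.
Proof.
case=> /and3P[cyc uniq_s _] max_s /and3P[pth uniq_t dis].
have [big|small] := ltnP 2 (size (u :: t ++ v :: s2)); last first.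
  by move: small; rewrite /= size_cat /=; lia.
have := max_s (u :: t ++ v :: s2).
rewrite /is_cycle big andbT /= !size_cat /= => le_t.
suff : size t + (size s2).+1 < (size s1 + (size s2).+1).+1 by lia.
apply: le_t; apply/andP; split.
  move: cyc pth; rewrite /= !rcons_path !path_cat_cons !last_cat_cons.
  by case/andP=> /and3P[_ _ ->] -> /andP[-> ->].
have : uniq (s1 ++ (u :: t ++ v :: s2)).
  rewrite (perm_uniq (s2 := t ++ u :: s1 ++ v :: s2)) ?cat_uniq ?uniq_t //.
    by rewrite -has_sym dis uniq_s.
  by apply/permP => P; do ?rewrite /= count_cat; rewrite /=; clear -s1 s2 t; lia.
by rewrite cat_uniq => /and3P[].
Qed.

(** Both arcs between the ends of an ear are at least as long as the ear, so an ear
    with two inner vertices completes a theta graph that contracts to E2. *)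
Lemma longest_ear_size1 (G : sgraph) (s t : seq G) (u v : G) :
    ~ minor E2 G -> longest_cycle s -> u \in s -> v \in s -> u != v ->
  ear s u v t -> size t <= 1.
Proof.
move=> nE2 long us vs uv; have [n s' def_s] := rot_to us.
rewrite -(ear_rot n); move: long => /(longest_rot n).
have: v \in s' by move: vs; rewrite -(mem_rot n) def_s inE eq_sym (negPf uv).
rewrite {}def_s => /splitPr[s1 s2] long e.
rewrite leqNgt; apply/negP => t2; apply: nE2.
have le1 := longest_ear long e.
(* The same bound for the other arc, by traversing the ear backwards. *)
have le2 : size t <= size s2.
  rewrite -(size_rev t); apply: (@longest_ear _ v u s2 s1).
    by have := longest_rot (size (u :: s1)) long; rewrite -cat_cons rot_size_cat.
  by rewrite -(ear_rot (size (v :: s2))) -cat_cons rot_size_cat /= ear_rev.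
case: long e => /and3P[cyc uniq_s _] _ /and3P[pth uniq_t dis].
apply: (@theta_E2 _ u v s1 t (rev s2)); rewrite ?size_rev ?(leq_trans t2) //.
  move: cyc; rewrite /= rcons_path path_cat_cons last_cat_cons.
  case/andP=> /and3P[p1 l1 p2] l2; rewrite rcons_path p1 l1 pth path_rev //.
  by rewrite rcons_path p2.
rewrite (perm_uniq (s2 := t ++ u :: s1 ++ v :: s2)).
  by rewrite cat_uniq uniq_t -has_sym dis uniq_s.
by apply/permP => P; do ?rewrite /= count_cat; rewrite /= count_rev; clear -s1 s2 t; lia.
Qed.

(** A path from a to a' outside s would give an ear from b to b' with at least two
    inner vertices. *)
Lemma no_two_exits (G : sgraph) (s : seq G) (x a a' b b' : G) :
    let e := fun y z : G => [&& adj y z, y \notin s & z \notin s] in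
    ~ minor E2 G -> longest_cycle s ->
    connect e x a -> connect e x a' -> x \notin s ->
    b \in s -> b' \in s -> b != b' -> adj a b -> adj a' b' -> a = a'.
Proof.
move=> e nE2 long xa xa' xs bs b's bb' ab a'b'.
have e_sym : symmetric e.
  by move=> y z; rewrite /e adj_sym; congr (_ && _); exact: andbC.
have : connect e a a' by apply: connect_trans xa'; rewrite sym_connect_sym.
case/connectP=> p /shortenP[t pth uniq_t _] {p} lst; apply/eqP/negPn/negP => neq_a.
have a_s : a \notin s.
  case/connectP: xa => p + ->; elim/last_ind: p => // p w _.
  by rewrite rcons_path last_rcons => /and4P[].
have dis : ~~ has (mem s) (a :: t).
  rewrite /= negb_or a_s /=; apply/hasPn => w wt /=.
  case/splitPr: wt pth {uniq_t lst} => p1 p2; rewrite path_cat_cons.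
  by case/and3P=> _ /and3P[].
have adj_t : path adj a t by apply: sub_path pth => y z /andP[].
have := @longest_ear_size1 _ s (a :: t) b b' nE2 long bs b's bb'.
rewrite /ear uniq_t dis /= rcons_path adj_sym ab adj_t -lst a'b' => /(_ isT).
by case: t lst {pth uniq_t dis adj_t} => //= eq_a; rewrite eq_a eqxx in neq_a.
Qed.

(** Suppose the component K of x outside s has a second vertex.  By 2-connectivity
    K has edges to two different vertices of s, and they start at the same vertex a of K
    by [no_two_exits].  The rest of K also has an edge to s, since a alone does not
    separate it from s, and this edge contradicts [no_two_exits]. *)
Lemma nbr_in_longest (G : sgraph) (s : seq G) (x y : G) :
    two_connected G -> ~ minor E2 G -> longest_cycle s -> x \notin s -> adj x y ->
  y \in s.
Proof.
move=> G2 nE2 long xs xy; apply/negPn/negP => ys.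
pose e (y z : G) := [&& adj y z, y \notin s & z \notin s].
pose K := [set z | connect e x z].
have xK : x \in K by rewrite inE connect0.
have Ks z : z \in K -> z \notin s.
  rewrite inE => /connectP[p + ->]; elim/last_ind: p => // p w _.
  by rewrite rcons_path last_rcons => /and4P[].
have out a b : a \in K -> b \notin K -> adj a b -> b \in s.
  move=> aK bK ab; apply: contraNT bK => bs; have a_s := Ks a aK.
  have xa : connect e x a by move: aK; rewrite inE.
  rewrite inE; apply: (connect_trans xa); apply: connect1.
  by rewrite /e ab a_s.
have sK z : z \in s -> z \notin K by move=> zs; apply: contraTN zs => /Ks.
have next b : exists2 c, c \in s & c != b.
  case: long => /and3P[_ + +] _.
  case: s {xs ys e K xK Ks out sK} => [|c [|d s]] //= /andP[+ _] _.
  rewrite inE negb_or => /andP[cd _]; have [eq_cb|] := eqVneq c b.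
    by exists d; rewrite ?inE ?eqxx ?orbT // -eq_cb eq_sym.
  by exists c; rewrite ?mem_head.
have [c0 c0s _] := next x.
have exit b : b \in s -> exists a b', [/\ a \in K, b' \in s, b' != b & adj a b'].
  move=> bs; have [c cs cb] := next b.
  have [a [b' [aK b'K b'b ab']]] := crossing_edge G2 xK (sK _ cs) (sK _ bs) cb.
  by exists a, b'; split=> //; apply: out ab'.
have [a [b [aK bs _ ab]]] := exit c0 c0s.
have [a' [b' [a'K b's b'b a'b']]] := exit b bs.
have two (a1 a2 b1 b2 : G) : a1 \in K -> a2 \in K -> b1 \in s -> b2 \in s -> b1 != b2 ->
    adj a1 b1 -> adj a2 b2 -> a1 = a2.
  by rewrite !inE => c1 c2; exact: (no_two_exits nE2 long c1 c2 xs).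
have eq_a : a' = a by apply: (two a' a b' b).
have yK : y \in K by rewrite inE; apply: connect1; rewrite /e xy xs ys.
have [z zK za] : exists2 z, z \in K & z != a.
  have [xa|] := eqVneq x a; last by exists x.
  by exists y => //; rewrite -xa; apply: contraTneq xy => ->; rewrite adj_irrefl.
have [||||a3 [b3 [+ b3K b3a ab3]]] := @crossing_edge _ (K :\ a) z c0 a G2.
- by rewrite in_setD1 za.
- by rewrite in_setD1 negb_and sK ?orbT.
- by rewrite in_setD1 eqxx.
- by apply: contraNneq (sK _ c0s) => ->.
rewrite in_setD1 => /andP[a3a a3K]; rewrite in_setD1 b3a /= in b3K.
have b3s := out _ _ a3K b3K ab3.
case/eqP: a3a; have [eq_b3|neq] := eqVneq b3 b.
  by rewrite -eq_a; apply: (two a3 a' b3 b') => //; rewrite eq_b3 eq_sym.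
exact: (two a3 a b3 b).
Qed.

Lemma outside_no_three (G : sgraph) (s : seq G) (x a b c : G) :
    ~ minor E1 G -> longest_cycle s -> x \notin s ->
    a \in s -> b \in s -> c \in s -> uniq [:: a; b; c] ->
  adj x a -> adj x b -> adj x c -> False.
Proof.
move=> nE1 long xs a_s; have [n s' def_s] := rot_to a_s.
rewrite -(mem_rot n) in xs; rewrite -(mem_rot n) -[c \in s](mem_rot n).
move: long => /(longest_rot n); rewrite {}def_s in xs *.
case=> /and3P[cyc uniq_s _] _; rewrite !inE.
move=> + + /and3P[+ + _]; rewrite !inE negb_or => + + /andP[ab ac] bc.
rewrite eq_sym (negPf ab) eq_sym (negPf ac) /= => /splitPr def_s'.
case: def_s' cyc uniq_s xs => s1 s2 cyc uniq_s xs.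
rewrite mem_cat inE eq_sym (negPf bc) /= => /orP[] /splitPr def_s12 xa xb xc; apply: nE1.
  case: def_s12 cyc uniq_s xs => s3 s4; rewrite -!catA /= => cyc uniq_s xs.
  by apply: (K4_hub cyc _ xa xc xb); rewrite cons_uniq xs.
case: def_s12 cyc uniq_s xs => s3 s4 cyc uniq_s xs.
by apply: (K4_hub cyc _ xa xb xc); rewrite cons_uniq xs.
Qed.

Lemma nbrs_of_outside (G : sgraph) (s : seq G) (x : G) :
    two_connected G -> ~ minor E1 G -> ~ minor E2 G -> longest_cycle s -> x \notin s ->
  exists a b, [/\ a \in s, b \in s, a != b & [set y | adj x y] = [set a; b]].
Proof.
move=> G2 nE1 nE2 long xs.
have in_s y : adj x y -> y \in s by exact: nbr_in_longest.
have [|z [zx _]] := third_vertex x x; first by case: G2.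
have [a xa _] := other_nbr G2 zx.
have [b xb ba] : exists2 b, adj x b & b != a.
  by apply: (other_nbr G2); apply: contraTneq xa => ->; rewrite adj_irrefl.
exists a, b; split; rewrite ?in_s //; first by rewrite eq_sym.
apply/setP => y; rewrite !inE; apply/idP/orP => [xy|[]/eqP->//].
apply/orP/negPn/negP; rewrite negb_or => /andP[ya yb].
apply: (@outside_no_three _ s x a b y) => //; rewrite ?in_s //=.
by rewrite !inE negb_or (eq_sym a b) (eq_sym a y) (eq_sym b y) ba ya yb.
Qed.

(** * Bridges of a longest cycle *)

(** The two last conditions say that i and j are not consecutive on the cycle,
    which excludes the edges of the cycle itself. *)
Definition bridge (G : sgraph) (x0 : G) (s : seq G) (i j : nat) (t : seq G) : bool :=
  [&& i < j, j < size s, ear s (nth x0 s i) (nth x0 s j) t,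
      1 < j - i & j - i < (size s).-1].

Lemma drop_slice (T : Type) (x0 : T) (s : seq T) (i j : nat) : i < j <= size s ->
  exists A, [/\ drop i s = nth x0 s i :: A ++ drop j s,
    last (nth x0 s i) A = nth x0 s j.-1 & size A = (j - i).-1].
Proof.
move=> /andP[lt_ij le_js]; exists (take (j - i.+1) (drop i.+1 s)); split.
- rewrite (drop_nth x0) ?(leq_trans lt_ij) //; congr (_ :: _).
  by rewrite -{1}(cat_take_drop (j - i.+1) (drop i.+1 s)) drop_drop subnK.
- rewrite (last_nth x0); set A := take _ _.
  have -> : size A = (j - i).-1 by rewrite size_takel ?size_drop ?leq_sub2r // subnS.
  have -> : nth x0 s i :: A = take (j - i) (drop i s).
    rewrite (drop_nth x0 (leq_trans lt_ij le_js)) /A subnS.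
    by case: (j - i) (subn_gt0 i j) => //; rewrite lt_ij.
  by rewrite nth_take ?nth_drop; [congr nth|]; lia.
- by rewrite size_takel ?size_drop ?leq_sub2r // subnS.
Qed.

(** An ear with an inner vertex cannot join consecutive vertices of a longest cycle. *)
Lemma bridge_far (G : sgraph) (x0 : G) (s : seq G) (i j : nat) (t : seq G) :
    longest_cycle s -> i < j < size s -> 0 < size t ->
  ear s (nth x0 s i) (nth x0 s j) t -> bridge x0 s i j t.
Proof.
move=> long /andP[lt_ij lt_js] t0 e; rewrite /bridge lt_ij lt_js e /=.
have [|A [defA _ szA]] := @drop_slice _ x0 s i j; first by rewrite lt_ij ltnW.
have rotE : rot i s = nth x0 s i :: A ++ nth x0 s j :: (drop j.+1 s ++ take i s).
  by rewrite /rot defA -cat_cons -catA (drop_nth x0 lt_js).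
rewrite -(ear_rot i) in e; have := longest_rot i long; rewrite rotE in e * => longA.
have leA := longest_ear longA e.
have longB := longest_rot (size (nth x0 s i :: A)) longA.
rewrite -cat_cons rot_size_cat /= in longB.
have leB : size (rev t) <= size (drop j.+1 s ++ take i s).
  apply: (longest_ear longB); apply: ear_rev.
  by rewrite -(ear_rot (size (nth x0 s i :: A))) -cat_cons rot_size_cat in e.
move: leA leB; rewrite szA size_rev size_cat size_drop size_takel; last lia.
lia.
Qed.

Lemma nth_rot (T : Type) (x0 : T) (s : seq T) (n i : nat) : n <= size s -> i < size s ->
  nth x0 (rot n s) i = nth x0 s (if i < size s - n then n + i else i - (size s - n)).
Proof.
move=> le_n lt_i; rewrite /rot nth_cat size_drop; case: ltnP => lt.
  by rewrite nth_drop.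
by rewrite nth_take //; lia.
Qed.

Lemma bridge_rotl (G : sgraph) (x0 : G) (s : seq G) (i j : nat) (t : seq G) :
  bridge x0 s i j t -> bridge x0 (rot i s) 0 (j - i) t.
Proof.
case/and5P=> lt_ij lt_js e far1 far2; rewrite /bridge size_rot ear_rot subn0.
rewrite !nth_rot; [|lia..].
rewrite !ifT; [|lia..].
by rewrite addn0 subnKC ?(ltnW lt_ij) // e far1 far2 subn_gt0 lt_ij /=; lia.
Qed.

Lemma bridge_rotr (G : sgraph) (x0 : G) (s : seq G) (i j : nat) (t : seq G) :
  bridge x0 s i j t -> bridge x0 (rot j s) 0 (size s - (j - i)) (rev t).
Proof.
case/and5P=> lt_ij lt_js e far1 far2; rewrite /bridge size_rot ear_rot subn0.
rewrite !nth_rot; [|lia..].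
rewrite ifT; last lia. rewrite ifF; last lia.
rewrite addn0; have -> : size s - (j - i) - (size s - j) = i by lia.
by rewrite (ear_rev e) /=; lia.
Qed.

Lemma bridge_rot1 (G : sgraph) (x0 : G) (s : seq G) (j : nat) (t : seq G) :
  bridge x0 s 0 j t -> bridge x0 (rot 1 s) j.-1 (size s).-1 (rev t).
Proof.
case/and5P=> lt_ij lt_js e far1 far2; rewrite /bridge size_rot ear_rot.
rewrite !nth_rot; [|lia..].
rewrite ifT; last lia. rewrite ifF; last lia.
have -> : 1 + j.-1 = j by lia.
have -> : (size s).-1 - (size s - 1) = 0 by lia.
by rewrite (ear_rev e) /=; lia.
Qed.

Section Bridges.
Variables (G : sgraph) (x0 : G) (s : seq G).
Hypotheses (nE1 : ~ minor E1 G) (nE2 : ~ minor E2 G) (nE3 : ~ minor E3 G).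
Hypothesis long : longest_cycle s.

Let c i := nth x0 s i.

Lemma uniq_long : uniq s. Proof. by case: long => /and3P[]. Qed.

Lemma nth_neq i j : i < j < size s -> c i != c j.
Proof.
case/andP=> lt_ij lt_js; rewrite nth_uniq ?uniq_long ?(ltn_trans lt_ij) //.
by rewrite neq_ltn lt_ij.
Qed.

Lemma bridge_size i j t : bridge x0 s i j t -> size t <= 1.
Proof.
case/and5P=> lt_ij lt_js e _ _; apply: (longest_ear_size1 nE2 long _ _ _ e).
- by rewrite mem_nth // (ltn_trans lt_ij).
- by rewrite mem_nth.
- by rewrite nth_neq // lt_ij.
Qed.

(** Bridges with different pairs of ends have at least three ends altogether, and
    a common middle vertex would be adjacent to all of them. *)
Lemma bridges_disjoint i j t i' j' t' : bridge x0 s i j t -> bridge x0 s i' j' t' ->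
  (i, j) != (i', j') -> ~~ has (mem t) t'.
Proof.
move=> b b'; have sz := bridge_size b; have sz' := bridge_size b'.
apply: contraNN => /hasP[x xt' xt].
move: b b' sz sz' xt xt'; case: t => [|x1 [|]] // b; case: t' => [|x2 [|]] // b' _ _.
rewrite !inE => /eqP eq1 /eqP eq2; subst x1 x2.
case/and5P: b => lt_ij lt_j /and3P[/= /and3P[ix xj _] _ xs] _ _.
case/and5P: b' => lt_ij' lt_j' /and3P[/= /and3P[ix' xj' _] _ _] _ _.
rewrite orbF in xs.
have three a b d : a < size s -> b < size s -> d < size s -> uniq [:: a; b; d] ->
    adj x (c a) -> adj x (c b) -> adj x (c d) -> False.
  move=> la lb ld; rewrite -(map_inj_in_uniq (f := c) (s := [:: a; b; d])).
    by apply: (outside_no_three nE1 long xs); apply: mem_nth.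
  move=> y z; rewrite !inE => /or3P[]/eqP-> /or3P[]/eqP-> /eqP;
    by rewrite nth_uniq ?uniq_long // => /eqP.
apply/negPn/negP; rewrite xpair_eqE negb_and => neq; have lt_i := ltn_trans lt_ij lt_j.
rewrite adj_sym in ix; rewrite adj_sym in ix'.
have [eq_i|neq_i] := eqVneq i i'.
  rewrite -eq_i eqxx /= in neq lt_ij'.
  by apply: (three i j j') => //=; rewrite !inE negb_or !(ltn_eqF, neq) // .
have [eq_j|neq_j] := eqVneq i' j.
  rewrite {}eq_j in lt_ij'; apply: (three i j j') => //=; rewrite !inE; lia.
apply: (three i j i') => //=; [lia|rewrite !inE; lia].
Qed.

Lemma bridges_no_cross i j k l t t' : i < j -> j < k -> k < l ->
  bridge x0 s i k t -> bridge x0 s j l t' -> False.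
Proof.
move=> ij jk kl b b'; apply: nE1.
have dis := bridges_disjoint b b'; rewrite xpair_eqE (ltn_eqF ij) in dis.
have {}dis := dis isT.
case/and5P: b => _ lt_ks /and3P[pth uniq_t dis_t] _ _.
case/and5P: b' => _ lt_ls /and3P[pth' uniq_t' dis_t'] _ _.
have [|A1 [eA1 _ _]] := @drop_slice _ x0 s i j; first by lia.
have [|A2 [eA2 _ _]] := @drop_slice _ x0 s j k; first by lia.
have [|A3 [eA3 _ _]] := @drop_slice _ x0 s k l; first by lia.
have rotE : rot i s = c i :: A1 ++ c j :: A2 ++ c k :: A3 ++ c l :: (drop l.+1 s ++ take i s).
  by rewrite /rot eA1 eA2 eA3 (drop_nth x0 lt_ls) -!(cat_cons, catA).
have [/and3P[cyc uniq_s _] _] := longest_rot i long.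
rewrite rotE in cyc uniq_s; apply: (K4_cross cyc _ pth pth').
rewrite -rotE in uniq_s *.
rewrite catA cat_uniq [uniq (t ++ t')]cat_uniq uniq_s uniq_t uniq_t' dis /= andbT.
apply/hasPn => x; rewrite mem_rot mem_cat => xs; apply/negP => /orP[] xt.
  by case/hasP: dis_t; exists x.
by case/hasP: dis_t'; exists x.
Qed.

(** Seen from position a, the cycle splits into T1, R1, T2, R2, T3, R3, where the
    R's are the interiors of the three arcs cut off (one of them, R3, contains
    position 0) and the T's are the parts between them. *)
Lemma bridges_no_triangle a i1 j1 i2 j2 t0 t1 t2 :
    0 < a -> a <= i1 -> j1 <= i2 -> j2 <= (size s).-1 ->
    bridge x0 s a (size s).-1 t0 -> bridge x0 s i1 j1 t1 -> bridge x0 s i2 j2 t2 ->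
  False.
Proof.
move=> a0 ai1 j1i2 j2n b0 b1 b2; apply: nE3.
have far1 : 1 < j1 - i1 by case/and5P: b1.
have far2 : 1 < j2 - i2 by case/and5P: b2.
have [lt1 lt2 le_a ltT1 ltR1] :
    [/\ j1 < (size s).-1, a < i2, a <= size s, a < i1.+1 <= size s & i1.+1 < j1 <= size s].
  by split; clear -far1 far2 a0 ai1 j1i2 j2n; lia.
have [ltT2 ltR2 ltT3] :
    [/\ j1 < i2.+1 <= size s, i2.+1 < j2 <= size s & j2 < size s <= size s].
  by split; clear -far1 far2 a0 ai1 j1i2 j2n; lia.
have dis01 : ~~ has (mem t0) t1.
  by apply: (bridges_disjoint b0 b1); rewrite xpair_eqE [_ == j1]gtn_eqF ?andbF.
have dis02 : ~~ has (mem t0) t2.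
  by apply: (bridges_disjoint b0 b2); rewrite xpair_eqE ltn_eqF.
have dis12 : ~~ has (mem t1) t2.
  apply: (bridges_disjoint b1 b2).
  by rewrite xpair_eqE ltn_eqF // (leq_trans _ j1i2) // -subn_gt0 ltnW.
case/and5P: b0 => _ _ /and3P[pth0 uniq0 dis0] _ _.
case/and5P: b1 => _ _ /and3P[pth1 uniq1 dis1] _ _.
case/and5P: b2 => _ _ /and3P[pth2 uniq2 dis2] _ _.
have [T1 [eT1 lT1 _]] := drop_slice x0 ltT1.
have [R1 [eR1 lR1 _]] := drop_slice x0 ltR1.
have [T2 [eT2 lT2 _]] := drop_slice x0 ltT2.
have [R2 [eR2 lR2 _]] := drop_slice x0 ltR2.
have [T3 [eT3 lT3 _]] := drop_slice x0 ltT3.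
rewrite drop_size cats0 in eT3.
case eR3 : (take a s) => [|y3 R3].
  by have := congr1 size eR3; rewrite size_takel //= => a_eq0; rewrite a_eq0 in a0.
have rotE : rot a s = (c a :: T1) ++ (c i1.+1 :: R1) ++ (c j1 :: T2) ++ (c i2.+1 :: R2) ++
    (c j2 :: T3) ++ y3 :: R3.
  by rewrite /rot eT1 eR1 eT2 eR2 eT3 eR3 /= -!(cat_cons, catA).
have [/and3P[cyc uniq_s _] _] := longest_rot a long.
rewrite rotE in cyc uniq_s; apply: (cycle_E3 cyc _ _ _ _ (t1 := t1) (t2 := t2) (t3 := rev t0)).
- rewrite -rotE in uniq_s *; rewrite (catA t2) (catA t1) cat_uniq uniq_s andbT; apply/andP; split.
    rewrite cat_uniq uniq1 cat_uniq uniq2 rev_uniq uniq0 has_cat !has_rev !negb_or /=.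
    by rewrite dis12 !(has_sym _ t0) dis01 dis02.
  apply/hasPn => x; rewrite mem_rot !mem_cat mem_rev => xs; apply/negP => /or3P[] xt.
  + by case/hasP: dis1; exists x.
  + by case/hasP: dis2; exists x.
  + by case/hasP: dis0; exists x.
- by rewrite lT1.
- by rewrite lT2.
- by rewrite lT3 path_rev.
Qed.

End Bridges.

(** Bridges with the same left end, or with the same right end, span nested intervals
    anyway, so this makes the intervals of all bridges a chain. *)
Definition nested_bridges (G : sgraph) (x0 : G) (s : seq G) : Prop :=
  forall i j t i' j' t', bridge x0 s i j t -> bridge x0 s i' j' t' -> i < i' -> j' <= j.

(** Among all bridges of all rotations of longest cycles, let one from position 0 to
    position j have j minimal, and rotate by one.  The arc of positions cut off by this
    bridge now runs through the end of the list, and its complement spans the positions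
    from j-1 to n-1.  By minimality and noncrossing no bridge has an end inside the arc,
    so all intervals lie in this range, where disjoint ones would give E3. *)
Lemma exists_nested (G : sgraph) (x0 : G) :
    two_connected G -> ~ minor E1 G -> ~ minor E2 G -> ~ minor E3 G ->
  exists2 s : seq G, longest_cycle s & nested_bridges x0 s.
Proof.
move=> G2 nE1 nE2 nE3; have [s0 long0] := exists_longest G2.
pose P j := `[< exists s t, longest_cycle s /\ bridge x0 s 0 j t >].
have [exP|noP] := EM (exists j, P j); last first.
  exists s0 => // i j t i' j' t' b _ _; case: noP; exists (j - i); apply/asboolP.
  by exists (rot i s0), t; split; [exact: longest_rot|exact: bridge_rotl].
have [j0 /asboolP[s [t0 [long b0]]] min_j0] := ex_minnP exP.
have min1 i j t : bridge x0 (rot 1 s) i j t -> j0 <= j - i <= size s - j0.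
  move=> b; have l1 := longest_rot 1 long.
  have le1 : j0 <= j - i.
    apply: min_j0; apply/asboolP; exists (rot i (rot 1 s)), t.
    by split; [exact: longest_rot|exact: bridge_rotl].
  have le2 : j0 <= size s - (j - i).
    apply: min_j0; apply/asboolP; exists (rot j (rot 1 s)), (rev t).
    by split; [exact: longest_rot|have := bridge_rotr b; rewrite size_rot].
  have lt_j : j < size s by case/and5P: b; rewrite size_rot.
  by clear -le1 le2 lt_j; lia.
exists (rot 1 s); first exact: longest_rot.
have l1 := longest_rot 1 long; have c0 := bridge_rot1 b0.
have j0_gt1 : 1 < j0 < (size s).-1 by case/and5P: b0; lia.
have inside i j t : bridge x0 (rot 1 s) i j t -> j0.-1 <= i.
  move=> b; rewrite leqNgt; apply/negP => lt_i; have := min1 _ _ _ b.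
  have lt_j : j < size s by case/and5P: b; rewrite size_rot.
  have [lt_jn|ge_jn] := ltnP j (size s).-1; last by lia.
  move=> le_j; apply: (bridges_no_cross nE1 nE2 l1 lt_i _ lt_jn b c0); lia.
move=> i j t i' j' t' b b' lt_i; rewrite leqNgt; apply/negP => lt_j.
have [lt_i'j|le_ji'] := ltnP i' j.
  exact: (bridges_no_cross nE1 nE2 l1 lt_i lt_i'j lt_j b b').
rewrite -(size_rot 1 s) in c0.
apply: (bridges_no_triangle nE1 nE2 nE3 l1 _ (inside _ _ _ b) le_ji' _ c0 b b'); first by lia.
by case/and5P: b'; lia.
Qed.

(** * The track around a longest cycle *)

(** The largest left end r of a bridge is a position such that all bridges pass
    over the edge from r to r+1. *)
Lemma bridges_cut (G : sgraph) (x0 : G) (s : seq G) :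
    2 < size s -> nested_bridges x0 s ->
  exists2 r, r.+1 < size s & forall i j t, bridge x0 s i j t -> i <= r < j.
Proof.
move=> s3 nest.
have [exB|noB] := EM (exists i, `[< exists j t, bridge x0 s i j t >]); last first.
  exists 0; first exact: ltnW.
  by move=> i j t b; case: noB; exists i; apply/asboolP; exists j, t.
have leB i : `[< exists j t, bridge x0 s i j t >] -> i <= size s.
  by case/asboolP=> j [t /and5P[lt_ij lt_j _ _ _]]; rewrite ltnW // (ltn_trans lt_ij).
case: (ex_maxnP exB leB) => r /asboolP[j0 [t0 b0]] max_r.
have [lt_rj lt_j] : r < j0 /\ j0 < size s by case/and5P: b0.
exists r; first exact: leq_ltn_trans lt_rj lt_j.
move=> i j t b; have le_ir : i <= r by apply: max_r; apply/asboolP; exists j, t.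
rewrite le_ir /=; have [lt_ir|le_ri] := ltnP i r.
  by apply: leq_trans lt_rj _; apply: nest b b0 lt_ir.
have -> : r = i by apply/eqP; rewrite eqn_leq le_ri le_ir.
by case/and5P: b.
Qed.

Lemma cycle_adj_nth (G : sgraph) (x0 : G) (s : seq G) (i : nat) :
  cycle adj s -> i.+1 < size s -> adj (nth x0 s i) (nth x0 s i.+1).
Proof.
case: s => // x s /(pathP x0) adj_s; rewrite [size _]/= ltnS => lt_i.
have := adj_s i; rewrite size_rcons ltnW // => /(_ isT).
by rewrite -rcons_cons !nth_rcons /= lt_i ltnW.
Qed.

Lemma cycle_adj_last (G : sgraph) (x0 : G) (s : seq G) :
  cycle adj s -> 0 < size s -> adj (nth x0 s 0) (nth x0 s (size s).-1).
Proof.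
case: s => // x s; rewrite /cycle rcons_path => /andP[_ lx] _.
by rewrite adj_sym [(size _).-1]/= -(last_nth x0).
Qed.

(** The first path runs through positions 0 to r, the second one backwards from
    n-1 to r+1.  All possible chords between them are taken: besides the two
    cycle edges that join the paths at both ends, they are bridges, and nested
    intervals make them noncrossing because the second path is reversed. *)
Lemma nested_track (G : sgraph) (x0 : G) (s : seq G) :
    two_connected G -> ~ minor E1 G -> ~ minor E2 G -> longest_cycle s ->
    nested_bridges x0 s ->
  track G.
Proof.
move=> G2 nE1 nE2 long nest; split=> //.
have [/and3P[cyc uniq_s s3] _] := long.
have [r lt_r cut] := bridges_cut s3 nest.
(* The second path occupies the n - r.+1 positions from r.+1 to n.-1. *)
pose n := size s; pose c i := nth x0 s i; pose l := n - r.+2.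
have c_inj i j : i < n -> j < n -> c i = c j -> i = j.
  by move=> lt_i lt_j /eqP; rewrite nth_uniq // => /eqP.
pose p (a : 'I_r.+1) := c a; pose q (b : 'I_l.+1) := c (n.-1 - b).
have le_a (a : 'I_r.+1) : a <= r by rewrite -ltnS.
have le_b (b : 'I_l.+1) : b <= l by rewrite -ltnS.
have lt_p (a : 'I_r.+1) : a < n by apply: leq_ltn_trans (le_a a) (ltnW lt_r).
have q_idx (b : 'I_l.+1) : r < n.-1 - b < n.
  by have := le_b b; rewrite /l; clear -lt_r; rewrite /n; lia.
have pP i : i <= r -> exists a : 'I_r.+1, i = a.
  by rewrite -ltnS => lt_i; exists (Ordinal lt_i).
have qP j : r < j < n -> exists b : 'I_l.+1, j = n.-1 - b.
  move=> lt_j; have lt_b : n.-1 - j < l.+1.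
    by move: lt_j; rewrite /l; clear -lt_r; rewrite /n; lia.
  exists (Ordinal lt_b) => /=.
  by move: lt_j; clear -lt_r; rewrite /n; lia.
have p_in a : p a \in s by apply: mem_nth; exact: lt_p.
have q_in b : q b \in s by apply: mem_nth; case/andP: (q_idx b).
have in_s x : x \in s -> (exists a, x = p a) \/ (exists b, x = q b).
  move=> /(nthP x0)[i lt_i <-]; have [/pP[a ->]|lt_ri] := leqP i r; first by left; exists a.
  by have [|b ->] := qP i; [rewrite lt_ri | right; exists b].
pose C : {set chord G r l} := [set x | `[< is_chord p q x >]].
have inC x : (x \in C) <-> is_chord p q x by rewrite inE; split=> /asboolP.
have bridge_short i j : i < j < n -> adj (c i) (c j) -> 1 < j - i < n.-1 ->
    bridge x0 s i j [::].
  case/andP=> lt_ij lt_jn ij far; rewrite /bridge lt_ij lt_jn /ear /= -/(c i) -/(c j) ij /=.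
  by [].
have bridge_long i j m : i < j < n -> m \notin s -> adj (c i) m -> adj m (c j) ->
    bridge x0 s i j [:: m].
  by move=> lt_ij ms im mj; apply: bridge_far; rewrite // /ear /= im mj orbF ms.
have chord_at a b o : is_chord p q (a, b, o) ->
    [\/ a = 0 :> nat /\ b = 0 :> nat, a = r :> nat /\ b = l :> nat
      | exists t, bridge x0 s a (n.-1 - b) t].
  have /andP[lt_rb lt_bn] := q_idx b.
  have lt_ab : a < n.-1 - b < n by rewrite lt_bn (leq_ltn_trans (le_a a)).
  case: o => [m [am mb _ mp mq]|ab].
    constructor 3; exists [:: m]; apply: bridge_long => //.
    by apply/negP => /in_s[[a' /mp]|[b' /mq]].
  have [far|] := boolP (1 < n.-1 - b - a < n.-1).
    by constructor 3; exists [::]; apply: bridge_short.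
  (* Consecutive positions are r and r.+1, or else 0 and n.-1. *)
  rewrite negb_and -!leqNgt => /orP[near|around].
    constructor 2; have := le_a a; have := le_b b; move: lt_rb lt_bn near lt_r.
    by rewrite /l; clear; rewrite /n; lia.
  by constructor 1; move: around lt_ab; clear; lia.
exists r, l, p, q, C; split.
- split; first split.
  + by move=> a a' /c_inj E; apply: val_inj; apply: E; exact: lt_p.
  + by move=> a a' eq_a'; rewrite /p eq_a'; apply: cycle_adj_nth => //; rewrite -eq_a'; exact: lt_p.
  + split.
      move=> b b' /c_inj E; apply: val_inj => /=.
      have /andP[_ lt_b] := q_idx b; have /andP[_ lt_b'] := q_idx b'.
      have := E lt_b lt_b'; have := le_b b; have := le_b b'.
      by rewrite /l; clear -lt_r; rewrite /n; lia.
    move=> b b' eq_b'; rewrite adj_sym /q.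
    have /andP[lt_b' lt_n] := q_idx b'; have /andP[_ lt_bn] := q_idx b.
    have -> : n.-1 - b = (n.-1 - b').+1 by move: lt_b'; rewrite eq_b'; clear; lia.
    apply: cycle_adj_nth => //.
    by move: lt_b' lt_bn; rewrite eq_b' -/n; clear; lia.
  + move=> a b eq_ab; have /andP[lt_rb lt_bn] := q_idx b.
    have := c_inj _ _ (lt_p a) lt_bn eq_ab; have := le_a a.
    by move: lt_rb; clear; lia.
- by move=> x /inC.
- case=> [[a b] o] [[a' b'] o'] /inC /chord_at ab /inC /chord_at ab'.
  apply/noncrossing_nat; have := le_a a; have := le_a a'; have := le_b b; have := le_b b'.
  case: ab => [[-> ->]|[-> ->]|[t B]].
  + by clear; split=> ?; lia.
  + by clear; split=> ?; lia.
  case: ab' => [[-> ->]|[-> ->]|[t' B']].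
  + by clear; split=> ?; lia.
  + by clear; split=> ?; lia.
  have /andP[lt_b _] := q_idx b; have /andP[lt_b' _] := q_idx b'.
  split=> lt_a; [have := nest _ _ _ _ _ _ B B' lt_a|have := nest _ _ _ _ _ _ B' B lt_a].
    by clear -lt_b lt_b'; lia.
  by clear -lt_b lt_b'; lia.
- split; exists None; apply/inC => /=.
    by rewrite /p /q /= subn0; apply: cycle_adj_last => //; exact: ltn_trans s3.
  rewrite /p /q /=; have -> : n.-1 - l = r.+1 by rewrite /l; clear -lt_r; rewrite /n; lia.
  exact: cycle_adj_nth.
have outside m : m \notin s -> exists a b,
    (a, b, Some m) \in C /\ forall v, adj m v -> v = p a \/ v = q b.
  move=> ms; have [x [y [xs ys xy Nm]]] := nbrs_of_outside G2 nE1 nE2 long ms.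
  have deg : degree m = 2 by rewrite /degree Nm cards2 xy.
  have adjN v : adj m v = (v == x) || (v == y).
    by have := in_set (fun v => adj m v) v; rewrite Nm !inE.
  have [i [j [lt_ij lt_jn ci cj adjm]]] : exists i j,
      [/\ i < j, j < n, adj (c i) m, adj m (c j) & forall v, adj m v -> v = c i \/ v = c j].
    case/(nthP x0): xs => i lt_i def_x; case/(nthP x0): ys => j lt_j def_y.
    have mi : adj m (c i) by rewrite adjN -def_x eqxx.
    have mj : adj m (c j) by rewrite adjN -def_y eqxx orbT.
    case: (ltngtP i j) => [lt_ij|lt_ji|eq_ij].
    - exists i, j; split=> //; first by rewrite adj_sym.
      by move=> v; rewrite adjN -def_x -def_y => /orP[]/eqP; auto.
    - exists j, i; split=> //; first by rewrite adj_sym.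
      by move=> v; rewrite adjN -def_x -def_y => /orP[]/eqP; auto.
    - by rewrite -def_x -def_y eq_ij eqxx in xy.
  have lt_ijn : i < j < n by rewrite lt_ij.
  have /andP[/pP[a def_i] lt_rj] := cut _ _ _ (bridge_long _ _ _ lt_ijn ms ci cj).
  have [|b def_j] := qP j; first by rewrite lt_rj.
  exists a, b; rewrite /p /q -def_i -def_j; split=> //; apply/inC; split=> //.
  + by rewrite /p -def_i.
  + by rewrite /q -def_j.
  + by move=> a' eq_m; rewrite eq_m p_in in ms.
  + by move=> b' eq_m; rewrite eq_m q_in in ms.
split.
  move=> v; have [/in_s[vp|vq]|/outside[a [b [Cab _]]]] := boolP (v \in s).
  - by constructor 1.
  - by constructor 2.
  - by constructor 3; exists a, b.
pose Q u v := [\/ path_edge p u v, path_edge q u v | exists2 x, x \in C & chord_edge p q x u v].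
have Q_sym u v : Q u v -> Q v u.
  case=> [[a [a' H]]|[b [b' H]]|[[[a b] o] Cx H]].
  - by constructor 1; exists a, a'; rewrite setUC.
  - by constructor 2; exists b, b'; rewrite setUC.
  - constructor 3; exists (a, b, o) => //; move: H; rewrite /chord_edge [X in X = _]setUC.
    by case: o {Cx} => // m; rewrite ![[set u; v]]setUC.
have Q_out u v : u \notin s -> adj u v -> Q u v.
  move=> /outside[a [b [Cab adju]]] /adju[] ->; constructor 3; exists (a, b, Some u) => //=.
    by left; rewrite setUC.
  by right.
have Q_in i j : i < j < n -> adj (c i) (c j) -> Q (c i) (c j).
  move=> lt_ij ij; have [/andP[/pP[a def_i] lt_rj]|/negP not_cut] := boolP (i <= r < j).
    have [|b def_j] := qP j; first by rewrite lt_rj; case/andP: lt_ij.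
    by constructor 3; exists (a, b, None); [apply/inC|]; rewrite /= /p /q -def_i -def_j.
  have [far|] := boolP (1 < j - i < n.-1).
    by case: not_cut; exact: cut (bridge_short _ _ _ _ far).
  rewrite negb_and -!leqNgt => near.
  have def_j : j = i.+1.
    by move: not_cut near lt_ij lt_r; clear; rewrite /n => /negP; lia.
  have [le_jr|lt_rj] := leqP j r.
    have [a def_a] : exists a : 'I_r.+1, i = a by apply: pP; rewrite ltnW // -def_j.
    have [a' def_a'] := pP j le_jr.
    by constructor 1; exists a, a'; rewrite /p -def_a -def_a'.
  have lt_ri : r < i.
    rewrite ltnNge; apply/negP => le_ir.
    by apply: not_cut; rewrite le_ir.
  have [|b def_b] := qP j; first by rewrite lt_rj; case/andP: lt_ij.
  have [|b' def_b'] := qP i; first by rewrite lt_ri; case/andP: lt_ij => /ltn_trans; apply.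
  constructor 2; exists b, b'; split; last by rewrite /q -def_b -def_b' setUC.
  have := le_b b; have := le_b b'; move: def_b def_b' def_j lt_ri lt_rj lt_ij; rewrite /l.
  by clear; lia.
move=> u v uv; have [us|/Q_out] := boolP (u \in s); last by apply.
have [vs|vs] := boolP (v \in s); last by apply/Q_sym/Q_out; rewrite // adj_sym.
case/(nthP x0): us uv => i lt_i <-; case/(nthP x0): vs => j lt_j <- ij.
case: (ltngtP i j) => [lt_ij|lt_ji|eq_ij]; last by rewrite eq_ij adj_irrefl in ij.
  by apply: Q_in; rewrite ?lt_ij.
by apply/Q_sym/Q_in; rewrite ?lt_ji // adj_sym.
Qed.

Theorem theorem3p1 (G : sgraph) :
  ((two_connected G /\ pathwidth G <= 2) <-> track G) /\
  (track G <->
     (two_connected G /\ [/\ ~ minor E1 G, ~ minor E2 G & ~ minor E3 G])).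
Proof.
have track_pw : track G -> two_connected G /\ pathwidth G <= 2.
  by move=> trG; split; [case: trG | apply/pathwidth_leP/track_bags2].
have pw_minor : two_connected G /\ pathwidth G <= 2 ->
    two_connected G /\ [/\ ~ minor E1 G, ~ minor E2 G & ~ minor E3 G].
  case=> G2 /pathwidth_leP bagsG; split=> //.
  have [b1 b2 b3] := obstructions_bags.
  by split=> /bags_le_minor/(_ bagsG).
have minor_track : two_connected G /\
    [/\ ~ minor E1 G, ~ minor E2 G & ~ minor E3 G] -> track G.
  case=> G2 [nE1 nE2 nE3]; have [G3 _ _] := G2.
  have /card_gt0P[x0 _] : 0 < #|G| by exact: leq_trans G3.
  have [s long nest] := exists_nested x0 G2 nE1 nE2 nE3.
  exact: nested_track G2 nE1 nE2 long nest.
by split; split; auto.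
Qed.
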